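(* There exists a $5$-uniform hypergraph $\mathcal{H}$ such that the strong game $\mathcal{R}^{(5)}(\mathcal{H}, \aleph_0)$ is a draw.
   Context: For an integer $k\ge 2$ and a finite $k$-uniform hypergraph $\mathcal{H}$, the strong Ramsey game $\mathcal{R}^{(k)}(\mathcal{H}, \aleph_0)$ is played by two players, FP (the first player) and SP (the second player), who alternately claim previously unclaimed edges of the countably infinite complete $k$-uniform hypergraph $K^k_{\mathbb{N}}$ (vertex set $\mathbb{N}$, edges all $k$-subsets), one edge per move, FP moving first. The first player whose claimed edges contain a copy of $\mathcal{H}$ (a subhypergraph isomorphic to $\mathcal{H}$) wins. If neither player has a strategy which ensures his win in finitely many moves, the game is declared a draw. *)

(* Defs.v *)
From mathcomp Require Import all_boot.
Set Implicit Arguments. Unset Strict Implicit. Unset Printing Implicit Defensive.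

(* An edge of the complete k-uniform hypergraph K^k_N on vertex set nat is
   represented canonically as the strictly increasing list of its k elements. *)
Definition edgeK (k : nat) (s : seq nat) : bool := sorted ltn s && (size s == k).

Definition uniform (k : nat) (V : finType) (E : {set {set V}}) : Prop :=
  forall e, e \in E -> #|e| = k.

Definition edge_image (V : finType) (f : V -> nat) (e : {set V}) : seq nat :=
  sort leq [seq f x | x <- enum e].

Definition has_copy (V : finType) (E : {set {set V}}) (S : seq (seq nat)) : Prop :=
  exists f : V -> nat, injective f /\ forall e, e \in E -> edge_image f e \in S.

(* A history is the sequence of moves played so far (move i at index i).
   FP plays the moves with even index, SP those with odd index.
   Player b : bool is FP when b = false and SP when b = true. *)
Definition claimed (b : bool) (h : seq (seq nat)) : seq (seq nat) :=
  [seq nth [::] h i | i <- iota 0 (size h) & odd i == b].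

Definition legal (k : nat) (h : seq (seq nat)) : bool := all (edgeK k) h && uniq h.

Definition strategy := seq (seq nat) -> seq nat.

Definition follows (b : bool) (sigma : strategy) (p : nat -> seq nat) : Prop :=
  forall i, odd i = b -> p i = sigma (mkseq p i).

Definition opp_legal (k : nat) (b : bool) (p : nat -> seq nat) : Prop :=
  forall i, odd i = ~~ b -> edgeK k (p i) /\ p i \notin mkseq p i.

(* sigma ensures a win of player b in finitely many moves: against every
   legal play of the opponent, after finitely many (legal) moves player b's
   edges contain a copy of H while the opponent's edges do not (hence the
   opponent never had a copy earlier, since claimed sets only grow). *)
Definition winning (k : nat) (V : finType) (E : {set {set V}}) (b : bool)
    (sigma : strategy) : Prop :=
  forall p : nat -> seq nat, follows b sigma p -> opp_legal k b p ->
    exists n, legal k (mkseq p n) /\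
      has_copy E (claimed b (mkseq p n)) /\
      ~ has_copy E (claimed (~~ b) (mkseq p n)).

Definition strong_game_draw (k : nat) (V : finType) (E : {set {set V}}) : Prop :=
  ~ (exists sigma, winning k E false sigma) /\
  ~ (exists sigma, winning k E true sigma).

(* Main.v *)
Require Import Defs.
From mathcomp Require Import all_boot.
From mathcomp Require Import zify.
From Stdlib Require Import Classical ClassicalEpsilon.
Set Implicit Arguments. Unset Strict Implicit. Unset Printing Implicit Defensive.

(* The hypergraph has a single vertex of degree 2, the apex [z], lying in two
   apical edges [r] and [g]; the other edges form the core. The second player
   builds a core as fast as possible: each of his edges contains a brand-new
   vertex, except the last one, which has two possible positions (exchanged by
   a pair of twins), and his opponent has only one move to spoil both. From
   then on, whenever the first player threatens to complete a copy, the second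
   player blocks. As soon as there is no threat, he claims [r] at a fresh apex,
   which forces the first player to answer [g] at that apex, and so on for
   ever. The forced answers are harmless because the fresh apex has degree 1
   among the edges of the first player.

   Two dangers have to be excluded, a double threat of the first player and a
   forced answer that is itself a threat. Both exclusions rest on rigidity: a
   map between the edges of two copies that is defined on all but two edges (or
   on all but two core edges) and preserves sizes of intersections is the
   identity. Hence consecutive threats differ only in the position of the
   apex, and any two cores owned by the first player have the same traces of
   [r] and [g] up to the twins, so that at least one of the orders [r], [g] and
   [g], [r] of the perpetual attack is safe.

   The second player cannot win either, by strategy stealing. *)

(** * The hypergraph, its copies and its cores *)

(* Edges 0-17 are the core, 18 and 19 are the apical edges [r] and [g], and 28 is
   the apex. Vertices 0 and 1 are twins: they lie in the same edges among the
   first 17, and edge 17 contains 0 only. For [j < 17], edge [j] contains a vertex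
   of no earlier edge, which for edge 16 is the vertex 27 of edge 17. The edges
   were found by a computer search for the rigidity and degree properties below. *)
Definition edges : seq (seq nat) :=
  [:: [:: 0; 1; 2; 3; 4]; [:: 0; 1; 5; 6; 7]; [:: 0; 1; 8; 9; 10];
      [:: 4; 7; 8; 11; 12]; [:: 2; 5; 9; 12; 13]; [:: 3; 6; 10; 13; 14];
      [:: 2; 11; 14; 15; 16]; [:: 4; 6; 15; 17; 18]; [:: 3; 5; 16; 17; 19];
      [:: 7; 9; 18; 19; 20]; [:: 4; 13; 16; 20; 21]; [:: 6; 8; 19; 21; 22];
      [:: 12; 14; 17; 22; 23]; [:: 10; 11; 18; 23; 24]; [:: 5; 15; 21; 24; 25];
      [:: 2; 20; 22; 25; 26]; [:: 3; 7; 24; 26; 27]; [:: 0; 13; 23; 25; 27];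
      [:: 1; 12; 18; 27; 28]; [:: 1; 13; 18; 26; 28]].

Definition ed (j : nat) : seq nat := nth [::] edges j.

Definition img (f : nat -> nat) (s : seq nat) : seq nat := sort leq (map f s).

Definition cp (f : nat -> nat) (j : nat) : seq nat := img f (ed j).

(** Maps are total on [nat], but only their values on the 29 vertices matter. *)
Definition inj (f : nat -> nat) : Prop :=
  forall i k, i < 29 -> k < 29 -> f i = f k -> i = k.

Definition copy (f : nat -> nat) (F : seq (seq nat)) : Prop :=
  inj f /\ forall j, j < 20 -> cp f j \in F.

Definition core (f : nat -> nat) (F : seq (seq nat)) : Prop :=
  inj f /\ forall j, j < 18 -> cp f j \in F.

(** On duplicate-free lists this is the size of the intersection, the invariant on which rigidity
    rests. *)
Definition isz (s t : seq nat) : nat := count (mem t) s.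

Lemma iota_all (P : pred nat) n i : all P (iota 0 n) -> i < n -> P i.
Proof. by move=> /allP H lt_in; apply: H; rewrite mem_iota. Qed.

Lemma ed_lt j v : v \in ed j -> v < 29.
Proof.
have H : all (all (fun v => v < 29)) edges by vm_compute.
case: (ltnP j 20) => [lt_j|ge_j]; last by rewrite /ed nth_default.
by move: (all_nthP [::] H j lt_j) => /allP; apply.
Qed.

Lemma ed_sorted j : j < 20 -> sorted ltn (ed j) && (size (ed j) == 5).
Proof.
have H : all (fun s => sorted ltn s && (size s == 5)) edges by vm_compute.
by move=> lt_j; move: (all_nthP [::] H j lt_j).
Qed.

Lemma ed_uniq j : uniq (ed j).
Proof.
case: (ltnP j 20) => [lt_j|ge_j]; last by rewrite /ed nth_default.
by case/andP: (ed_sorted lt_j) => /(sorted_uniq ltn_trans ltnn).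
Qed.

Lemma mem_img f s x : reflect (exists2 v, v \in s & x = f v) (x \in img f s).
Proof. by rewrite mem_sort; apply: mapP. Qed.

Lemma img_inE (f : nat -> nat) s v :
  (forall w, w \in s -> f v = f w -> v = w) -> (f v \in img f s) = (v \in s).
Proof.
move=> H; apply/mem_img/idP => [[w ws /H->//]|vs]; by exists v.
Qed.

Lemma cp_inE f j v : inj f -> v < 29 -> (f v \in cp f j) = (v \in ed j).
Proof. by move=> fI lt_v; apply: img_inE => w /ed_lt lt_w; apply: fI. Qed.

Lemma cpP f j x : reflect (exists2 v, v \in ed j & x = f v) (x \in cp f j).
Proof. exact: mem_img. Qed.

Lemma img_sorted f s : {in s &, injective f} -> uniq s -> sorted ltn (img f s).
Proof.
move=> fI us; rewrite ltn_sorted_uniq_leq sort_uniq map_inj_in_uniq // us.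
exact: sort_sorted leq_total _.
Qed.

Lemma sorted_ext (s t : seq nat) :
  sorted ltn s -> sorted ltn t -> s =i t -> s = t.
Proof. exact: irr_sorted_eq ltn_trans ltnn _ _. Qed.

Lemma inj_ed f j : inj f -> {in ed j &, injective f}.
Proof. by move=> fI v w /ed_lt vj /ed_lt wj; apply: fI. Qed.

Lemma cp_edge f j : inj f -> j < 20 -> edgeK 5 (cp f j).
Proof.
move=> fI lt_j; rewrite /edgeK img_sorted ?ed_uniq //; last exact: inj_ed.
by rewrite size_sort size_map; case/andP: (ed_sorted lt_j).
Qed.

Lemma eq_img f g s : {in s, f =1 g} -> img f s = img g s.
Proof. by move=> /eq_in_map E; rewrite /img E. Qed.

Lemma isz_img f s t : {in s ++ t &, injective f} ->
  isz (img f s) (img f t) = isz s t.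
Proof.
move=> fI; rewrite /isz /img (permP (permEl (perm_sort _ _))) count_map.
apply: eq_in_count => v vs /=; apply: img_inE => w wt; apply: fI;
  by rewrite mem_cat ?vs ?wt ?orbT.
Qed.

Lemma isz_cp f j k : inj f -> isz (cp f j) (cp f k) = isz (ed j) (ed k).
Proof.
move=> fI; apply: isz_img => v w.
rewrite !mem_cat => /orP[]/ed_lt lt_v /orP[]/ed_lt lt_w; exact: fI.
Qed.

Lemma isz_le3 j k : j < 20 -> k < 20 -> j != k -> isz (ed j) (ed k) <= 3.
Proof.
have H : all (fun j => all (fun k => (j != k) ==> (isz (ed j) (ed k) <= 3))
  (iota 0 20)) (iota 0 20) by vm_compute.
by move=> lt_j lt_k; apply/implyP; exact: iota_all (iota_all H lt_j) lt_k.
Qed.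

Lemma isz_refl j : j < 20 -> isz (ed j) (ed j) = 5.
Proof.
have H : all (fun j => isz (ed j) (ed j) == 5) (iota 0 20) by vm_compute.
by move=> lt_j; apply/eqP; exact: iota_all H lt_j.
Qed.

(** An edge meets itself in 5 vertices and any other edge in at most 3. *)
Lemma cp_inj f j k : inj f -> j < 20 -> k < 20 -> cp f j = cp f k -> j = k.
Proof.
move=> fI lt_j lt_k E; apply/eqP; apply: contraT => /(isz_le3 lt_j lt_k).
by rewrite -(isz_cp _ _ fI) -E isz_cp // isz_refl.
Qed.

Lemma cp_filter_uniq f n (P : pred nat) : inj f -> n <= 20 ->
  uniq [seq cp f j | j <- iota 0 n & P j].
Proof.
move=> fI le_n; rewrite map_inj_in_uniq ?filter_uniq ?iota_uniq //.
move=> j k; rewrite !mem_filter !mem_iota => /andP[_ /= lt_j] /andP[_ /= lt_k].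
by apply: cp_inj => //; lia.
Qed.

Lemma cp_filter_size f n (P : pred nat) (L : seq (seq nat)) : inj f -> n <= 20 ->
  (forall j, j < n -> P j -> cp f j \in L) ->
  size [seq j <- iota 0 n | P j] <= size L.
Proof.
move=> fI le_n H; rewrite -(size_map (cp f)).
apply: uniq_leq_size; first exact: cp_filter_uniq.
move=> x /mapP[j]; rewrite mem_filter mem_iota => /andP[Pj /= lt_j] ->.
exact: H.
Qed.

Lemma copy_size f F : copy f F -> 20 <= size F.
Proof.
case=> fI H; have := @cp_filter_size f 20 predT F fI isT.
by rewrite filter_predT size_iota; apply=> j lt_j _; exact: H.
Qed.

(** * Rigidity *)

(** Evaluated once and for all, so that the search below only looks up numbers. *)
Definition isz_table : seq (seq nat) :=
  Eval vm_compute in [seq [seq isz s t | t <- edges] | s <- edges].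

Lemma isz_tableE j k : j < 20 -> k < 20 ->
  nth 0 (nth [::] isz_table j) k = isz (ed j) (ed k).
Proof.
have H : all (fun j => all (fun k =>
  nth 0 (nth [::] isz_table j) k == isz (ed j) (ed k))
  (iota 0 20)) (iota 0 20) by vm_compute.
by move=> lt_j lt_k; apply/eqP; exact: iota_all (iota_all H lt_j) lt_k.
Qed.

(* [todo] lists the source edges still to be mapped together with their
   remaining candidate targets; [b] source edges may be left unmapped. *)
Fixpoint rigid_search (n : nat) (todo : seq (nat * seq nat)) (b : nat)
    (ident : bool) : bool :=
  if b < count (fun p => nilp p.2) todo then true else
  match n, todo with
  | n'.+1, (j, c) :: t =>
      (if b is b'.+1 then rigid_search n' t b' ident else true) &&
      let row_j := nth [::] isz_table j in
      all (fun k =>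
        let row_k := nth [::] isz_table k in
        rigid_search n'
          [seq (p.1, let i := nth 0 row_j p.1 in
            [seq l <- p.2 | if nth 0 row_k l == i then l != k else false])
          | p <- t]
          b (ident && (j == k))) c
  | _, _ => ident
  end.

(** Soundness of the search along the branch guided by [pi], where [Q] marks the unmapped sources. A
    source without candidates must lie in [Q], so on this branch the pruning test never succeeds;
    [ident] records that every choice made so far was the identity. *)
Lemma rigid_searchP (pi : nat -> nat) (Q : pred nat) n todo b ident :
  size todo <= n -> rigid_search n todo b ident ->
  uniq (unzip1 todo) ->
  (forall p, p \in todo -> ~~ Q p.1 -> pi p.1 \in p.2) ->
  (forall j k, j \in unzip1 todo -> k \in unzip1 todo -> ~~ Q j -> ~~ Q k ->
     j != k -> pi j != pi k /\ nth 0 (nth [::] isz_table (pi j)) (pi k) =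
       nth 0 (nth [::] isz_table j) k) ->
  count Q (unzip1 todo) <= b ->
  ident /\ forall j, j \in unzip1 todo -> ~~ Q j -> pi j = j.
Proof.
elim: n todo b ident => [|n IHn] [|[j c] t] b ident //=; try by case: ifP.
rewrite ltnS => le_n S /andP[jt ut] C K le_b.
have: ~~ (b < nilp c + count (fun p => nilp p.2) t).
  rewrite -leqNgt; apply: leq_trans le_b; apply: leq_add.
    case: (boolP (Q j)) => [_|nQj]; first by case: (nilp c).
    by have := C (j, c) (mem_head _ _) nQj; case: (c).
  rewrite /unzip1 count_map.
  rewrite (@eq_in_count _ _ (fun p => Q p.1 && nilp p.2)) => [|p pt].
    by apply: sub_count => p /= /andP[].
  apply/idP/andP => [p0|[]//]; split=> //; apply: contraT => nQ.
  have := C p; rewrite in_cons pt orbT => /(_ isT nQ).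
  by move/nilP: p0 => ->.
move/negbTE => E; move: S; rewrite E => /andP[S1 /allP S2].
have Ct p : p \in t -> ~~ Q p.1 -> pi p.1 \in p.2.
  by move=> pt; apply: C; rewrite in_cons pt orbT.
have Kt k l : k \in unzip1 t -> l \in unzip1 t -> ~~ Q k -> ~~ Q l -> k != l ->
    pi k != pi l /\ nth 0 (nth [::] isz_table (pi k)) (pi l) =
       nth 0 (nth [::] isz_table k) l.
  by move=> kt lt; apply: K; rewrite in_cons ?kt ?lt orbT.
case: (boolP (Q j)) => [Qj|nQj].
  move: le_b; rewrite Qj; case: b S1 {E S2} => [//|b] S1 le_b.
  have [id_ H] := IHn t b ident le_n S1 ut Ct Kt le_b.
  by split=> // k; rewrite in_cons => /predU1P[->|/H//]; rewrite Qj.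
have cj : pi j \in c by exact: C (j, c) (mem_head _ _) nQj.
have {S2}S2 := S2 _ cj.
set t' := map _ t in S2.
have t't : unzip1 t' = unzip1 t by rewrite /unzip1 -map_comp.
have := IHn t' b _ _ S2; rewrite size_map t't => /(_ le_n ut).
case=> //.
- move=> p /mapP[q qt ->] /= nQq; rewrite mem_filter (Ct q) // andbT.
  have jq : j != q.1 by apply: contraNneq jt => ->; exact: map_f.
  have [||N ->] := K j q.1 _ _ nQj nQq jq; rewrite ?in_cons ?eqxx //.
    by rewrite (map_f _ qt) orbT.
  by rewrite eq_sym.
- by move: le_b; rewrite (negbTE nQj).
move=> /andP[id_ /eqP jE] H; split=> // k.
by rewrite in_cons => /predU1P[->|/H//].
Qed.

(** All 20 edges are candidates even when only core edges are sources: a core edge might a priori be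
    mapped to an apical one. *)
Definition full_todo n := [seq (j, iota 0 20) | j <- iota 0 n].

Lemma rigid20 : rigid_search 20 (full_todo 20) 2 true.
Proof. by vm_compute. Qed.

Lemma rigid18 : rigid_search 18 (full_todo 18) 2 true.
Proof. by vm_compute. Qed.

(** Sending [j] to the index of the edge of [g] that equals [cp f j] preserves intersection sizes,
    because [f] and [g] both do; the search then shows that this map is the identity. *)
Lemma rigid_cp f g n (Q : seq nat) :
  inj f -> inj g -> n \in [:: 18; 20] -> size Q <= 2 ->
  (forall j, j < n -> j \notin Q -> exists2 k, k < 20 & cp f j = cp g k) ->
  forall j, j < n -> j \notin Q -> cp f j = cp g j.
Proof.
move=> fI gI n_in szQ H.
have le_n : n <= 20 by move: n_in; rewrite !inE => /orP[]/eqP->.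
pose pi j := index (cp f j) (map (cp g) (iota 0 20)).
have piP j : j < n -> j \notin Q -> pi j < 20 /\ cp f j = cp g (pi j).
  move=> lt_j /(H j lt_j)[k lt_k E].
  have in_ : cp f j \in map (cp g) (iota 0 20).
    by rewrite E map_f // mem_iota.
  have lt_pi : pi j < 20 by move: in_; rewrite -index_mem size_map size_iota.
  split=> //; have := nth_index [::] in_.
  by rewrite (nth_map 0) ?size_iota // nth_iota.
have t1 : unzip1 (full_todo n) = iota 0 n by rewrite /unzip1 -map_comp map_id.
have S : rigid_search n (full_todo n) 2 true.
  by move: n_in; rewrite !inE => /orP[]/eqP->; rewrite ?rigid18 ?rigid20.
have [||||| _] := @rigid_searchP pi (mem Q) _ _ _ _ _ S.
- by rewrite size_map size_iota.
- by rewrite t1 iota_uniq.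
- move=> p /mapP[j]; rewrite mem_iota => /= lt_j -> nQ.
  by change (pi j \in iota 0 20); rewrite mem_iota; case: (piP j lt_j nQ).
- move=> j k; rewrite t1 !mem_iota /= => lt_j lt_k nQj nQk jk.
  have [pj Ej] := piP j lt_j nQj; have [pk Ek] := piP k lt_k nQk; split.
    apply: contraNneq jk => E; apply/eqP; apply: cp_inj fI _ _ _; try lia.
    by rewrite Ej Ek E.
  by rewrite !isz_tableE //; try lia; rewrite -(isz_cp _ _ gI) -Ej -Ek isz_cp.
- rewrite t1 -size_filter; apply: leq_trans szQ; apply: uniq_leq_size.
    by rewrite filter_uniq ?iota_uniq.
  by move=> j; rewrite mem_filter => /andP[].
move=> R j lt_j nQ; have [_ ->] := piP j lt_j nQ.
by rewrite R // t1 mem_iota.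
Qed.

(** * From common edges to common vertices *)

Section Agree.
Variables (f g : nat -> nat) (n : nat) (Q : seq nat).
Hypotheses (fI : inj f) (gI : inj g).
Hypothesis agree : forall j, j < n -> j \notin Q -> cp f j = cp g j.

Lemma vertex_image v : (exists2 j, j < n & (j \notin Q) && (v \in ed j)) ->
  exists2 w, w < 29 & f v = g w /\
    forall j, j < n -> j \notin Q -> (v \in ed j) = (w \in ed j).
Proof.
case=> j lt_j /andP[nQ vj].
have: f v \in cp f j by apply/cpP; exists v.
rewrite (agree lt_j nQ) => /cpP[w wj E]; exists w; first exact: ed_lt wj.
split=> // k lt_k nQk.
by rewrite -(cp_inE _ fI (ed_lt vj)) (agree lt_k nQk) E cp_inE ?(ed_lt wj).
Qed.

Lemma notin_subset (s : seq nat) : uniq s -> size Q < size s ->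
  exists2 j, j \in s & j \notin Q.
Proof.
move=> us lt_s; apply/hasP; apply: contraTT lt_s => /hasPn H.
rewrite -leqNgt; apply: uniq_leq_size => // j /H; by rewrite negbK.
Qed.

Definition inc m v := [seq j <- iota 0 m | v \in ed j].
Definition sdiff m v w := [seq j <- iota 0 m | (v \in ed j) != (w \in ed j)].

(** The value [f v] equals some [g w] with [v] and [w] in the same edges outside [Q]; if more than
    [size Q] edges separate [v] from every other vertex, then [w] is [v]. *)
Lemma vertex_agree v :
  (exists2 j, j < n & (j \notin Q) && (v \in ed j)) ->
  (forall w, w < 29 -> w != v -> size Q < size (sdiff n v w)) -> f v = g v.
Proof.
move=> /vertex_image[w lt_w [E H]] D; rewrite E.
case: (eqVneq w v) => [->//|/(D w lt_w)/notin_subset[]].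
  by rewrite filter_uniq ?iota_uniq.
move=> j; rewrite mem_filter mem_iota => /andP[N /= lt_j] /(H j lt_j) E1.
by rewrite E1 eqxx in N.
Qed.

Lemma inc_notin v : size Q < size (inc n v) ->
  exists2 j, j < n & (j \notin Q) && (v \in ed j).
Proof.
case/notin_subset; first by rewrite filter_uniq ?iota_uniq.
move=> j; rewrite mem_filter mem_iota => /andP[vj /= lt_j] nQ.
by exists j => //; rewrite nQ.
Qed.

End Agree.

Lemma degree_ge3 v : v < 28 -> 3 <= size (inc 20 v).
Proof.
have H : all (fun v => 3 <= size (inc 20 v)) (iota 0 28) by vm_compute.
exact: (iota_all H).
Qed.

Lemma core_degree_ge2 v : v < 28 -> 2 <= size (inc 18 v).
Proof.
have H : all (fun v => 2 <= size (inc 18 v)) (iota 0 28) by vm_compute.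
exact: (iota_all H).
Qed.

Lemma sdiff20 v w : v < 29 -> w < 29 -> w != v -> 3 <= size (sdiff 20 v w).
Proof.
have H : all (fun v => all (fun w => (w != v) ==> (3 <= size (sdiff 20 v w)))
  (iota 0 29)) (iota 0 29) by vm_compute.
by move=> lt_v lt_w; apply/implyP; exact: iota_all (iota_all H lt_v) lt_w.
Qed.

Lemma apex_mem j : (28 \in ed j) = (j \in [:: 18; 19]).
Proof.
have H : all (fun j => (28 \in ed j) == (j \in [:: 18; 19])) (iota 0 20).
  by vm_compute.
case: (ltnP j 20) => [lt_j|ge_j]; first by apply/eqP; exact: iota_all H lt_j.
rewrite /ed nth_default // !inE; symmetry; apply/negbTE; lia.
Qed.

(** Off the apex all degrees are at least 3, and any two vertices are separated by at least 3 edges,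
    so losing two edges does no harm. The apex has degree 2 and is determined as soon as one of its
    edges survives. *)
Lemma agree20 f g (Q : seq nat) : inj f -> inj g -> size Q <= 2 ->
  (forall j, j < 20 -> j \notin Q -> cp f j = cp g j) ->
  (forall v, v < 28 -> f v = g v) /\
  (~~ ((18 \in Q) && (19 \in Q)) -> f 28 = g 28).
Proof.
move=> fI gI szQ H; split=> [v lt_v|nQ].
  apply: (vertex_agree fI gI H).
    by apply: inc_notin; apply: leq_ltn_trans szQ _; exact: degree_ge3.
  move=> w lt_w wv; apply: leq_ltn_trans szQ _; apply: sdiff20 => //; lia.
apply: (vertex_agree fI gI H); last first.
  by move=> w lt_w wv; apply: leq_ltn_trans szQ _; exact: sdiff20.
by case/nandP: nQ => nQ; [exists 18|exists 19]; rewrite // nQ apex_mem.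
Qed.

Definition swap (v : nat) : nat := if v == 0 then 1 else if v == 1 then 0 else v.

(** The vertices of the apical edges other than the apex, together with 0, the twin of 1. *)
Definition hub : seq nat := [:: 0; 1; 12; 13; 18; 26; 27].

Lemma sdiff18_hub v w : v \in [:: 12; 13; 18; 26; 27] -> w < 29 -> w != v ->
  2 <= size (sdiff 18 v w).
Proof.
have H : all (fun v => all (fun w => (w != v) ==> (2 <= size (sdiff 18 v w)))
  (iota 0 29)) [:: 12; 13; 18; 26; 27] by vm_compute.
by move=> /(allP H) Hv lt_w; apply/implyP; exact: iota_all Hv lt_w.
Qed.

Lemma sdiff18_twin v w : v < 2 -> 1 < w -> w < 29 -> 2 <= size (sdiff 18 v w).
Proof.
have H : all (fun v => all (fun w => (1 < w) ==> (2 <= size (sdiff 18 v w)))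
  (iota 0 29)) (iota 0 2) by vm_compute.
move=> lt_v gt_w lt_w; exact: (implyP (iota_all (iota_all H lt_v) lt_w)).
Qed.

Definition twin_rel (f g : nat -> nat) : Prop :=
  {in hub, f =1 g} \/ {in hub, forall v, f v = g (swap v)}.

Lemma hub_swap v : v \in hub -> swap v \in hub.
Proof. by apply/allP: v. Qed.

Lemma swapK : involutive swap.
Proof. by case=> [|[|v]]. Qed.

Lemma twin_rel_trans f g h : twin_rel f h -> twin_rel g h -> twin_rel f g.
Proof.
move=> [Hf|Hf] [Hg|Hg]; [left|right|right|left] => v vh.
- by rewrite Hf ?Hg.
- by rewrite Hf // Hg ?hub_swap // swapK.
- by rewrite Hf // Hg ?hub_swap.
- by rewrite Hf // Hg.
Qed.

(** With one core edge lost, every hub vertex still lies in a common edge, and two core edges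
    separate it from each other vertex, except for the twins, which only edge 17 separates. *)
Lemma core_twin_rel f g (Q : seq nat) : inj f -> inj g -> size Q <= 1 ->
  (forall j, j < 18 -> j \notin Q -> exists2 k, k < 20 & cp f j = cp g k) ->
  twin_rel f g.
Proof.
move=> fI gI szQ H.
have szQ2 : size Q <= 2 by exact: leq_trans szQ _.
have A := @rigid_cp f g 18 Q fI gI isT szQ2 H.
have V v : v \in [:: 12; 13; 18; 26; 27] -> f v = g v.
  move=> vh; apply: (vertex_agree fI gI A).
    apply: inc_notin; apply: leq_ltn_trans szQ _; apply: core_degree_ge2.
    by apply/allP: v vh.
  by move=> w lt_w wv; apply: leq_ltn_trans szQ _; exact: sdiff18_hub.
have T v : v < 2 -> f v = g 0 \/ f v = g 1.
  move=> lt_v; have [|w lt_w [-> E]] := vertex_image fI gI A (v := v).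
    apply: inc_notin; apply: leq_ltn_trans szQ _; apply: core_degree_ge2; lia.
  case: w lt_w E => [|[|w]] lt_w E; [by left|by right|].
  have [||j js jQ] := @notin_subset Q (sdiff 18 v w.+2).
  - by rewrite filter_uniq ?iota_uniq.
  - by apply: leq_ltn_trans szQ _; exact: sdiff18_twin.
  move: js; rewrite mem_filter mem_iota => /andP[N /= lt_j].
  by rewrite (E j lt_j jQ) eqxx in N.
have N01 : f 0 <> f 1 by move/fI => /(_ isT isT).
case: (T 0 isT) => E0; case: (T 1 isT) => E1; try by rewrite E0 E1 in N01.
- left=> v; rewrite in_cons => /orP[/eqP->//|].
  by rewrite in_cons => /orP[/eqP->//|]; exact: V.
right=> v; rewrite in_cons => /orP[/eqP->//|].
rewrite in_cons => /orP[/eqP->//|vh]; rewrite V //.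
by rewrite /swap; case: eqP vh => [->|_] //; case: eqP => [->|].
Qed.

(** * The perpetual attack *)

Definition apical (T : nat) : bool := (T == 18) || (T == 19).

Definition base (T : nat) : seq nat := [seq v <- ed T | v != 28].

Definition upd (f : nat -> nat) (z v : nat) : nat := if v == 28 then z else f v.

Lemma apical_lt T : apical T -> T < 20.
Proof. by case/orP=> /eqP->. Qed.

(** The map [37 - T] exchanges the apical edges 18 and 19. *)
Lemma apical_opp T : apical T -> apical (37 - T).
Proof. by case/orP=> /eqP->. Qed.

Lemma apical_oppK T : apical T -> 37 - (37 - T) = T.
Proof. by case/orP=> /eqP->. Qed.

Lemma apical_opp_neq T : apical T -> 37 - T != T.
Proof. by case/orP=> /eqP->. Qed.

Lemma apical_neq T U : apical T -> apical U -> T != U -> U = 37 - T.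
Proof. by case/orP=> /eqP-> /orP[]/eqP->. Qed.

Lemma nonapical_core j : j < 20 -> ~~ apical j -> j < 18.
Proof. rewrite /apical; lia. Qed.

Lemma core_nonapical j : j < 18 -> ~~ apical j.
Proof. rewrite /apical; lia. Qed.

Lemma apexE j : (28 \in ed j) = apical j.
Proof. by rewrite apex_mem !inE. Qed.

Lemma core_lt28 j v : j < 18 -> v \in ed j -> v < 28.
Proof.
move=> lt_j vj; have := ed_lt vj; have: v != 28.
  by apply: contraTneq vj => ->; rewrite apexE core_nonapical.
lia.
Qed.

Lemma base_lt28 T v : v \in base T -> v < 28.
Proof. by rewrite mem_filter => /andP[N /ed_lt]; lia. Qed.

Lemma inj_upd f z : inj f -> (forall v, v < 28 -> f v <> z) -> inj (upd f z).
Proof.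
move=> fI N i k lt_i lt_k; rewrite /upd.
case: eqP => [->|Ni]; case: eqP => [->|Nk] // E.
- by case: (N k) => //; lia.
- by case: (N i) => //; lia.
- exact: fI.
Qed.

Lemma upd_lt f z v : v < 28 -> upd f z v = f v.
Proof. by rewrite /upd; case: eqP => // ->. Qed.

Lemma cp_upd f z j : j < 18 -> cp (upd f z) j = cp f j.
Proof. by move=> lt_j; apply: eq_img => v /(core_lt28 lt_j) /upd_lt ->. Qed.

Lemma base_eq f g T : (forall v, v < 28 -> f v = g v) ->
  img f (base T) = img g (base T).
Proof. by move=> E; apply: eq_img => v /base_lt28/E. Qed.

Lemma eq_cp f g j : (forall v, v < 29 -> f v = g v) -> cp f j = cp g j.
Proof. by move=> E; apply: eq_img => v /ed_lt/E. Qed.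

Lemma eq_cp_core f g j : (forall v, v < 28 -> f v = g v) -> j < 18 ->
  cp f j = cp g j.
Proof. by move=> E lt_j; apply: eq_img => v /(core_lt28 lt_j)/E. Qed.

Lemma mem_base f T x : inj f -> (x \in img f (base T)) = (x \in cp f T) && (x != f 28).
Proof.
move=> fI; apply/mem_img/andP => [[v]|[/cpP[v vT ->] N]].
  rewrite mem_filter => /andP[N vT] ->; split; first by apply/cpP; exists v.
  by apply: contraNneq N => /fI-> //; exact: ed_lt vT.
by exists v => //; rewrite mem_filter vT andbT; apply: contraNneq N => ->.
Qed.

Lemma sorted_cp f j : inj f -> sorted ltn (cp f j).
Proof. by move=> fI; apply: img_sorted (ed_uniq _); exact: inj_ed. Qed.

Lemma sorted_base f T : inj f -> sorted ltn (img f (base T)).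
Proof.
move=> fI; apply: img_sorted; last by rewrite filter_uniq ?ed_uniq.
by move=> v w /base_lt28 lt_v /base_lt28 lt_w; apply: fI; lia.
Qed.

Lemma base_cp f g T U : inj f -> inj g -> f 28 = g 28 -> cp f T = cp g U ->
  img f (base T) = img g (base U).
Proof.
move=> fI gI E28 E; apply: sorted_ext; rewrite ?sorted_base // => x.
by rewrite !mem_base // E E28.
Qed.

Lemma cp_base f g T U : inj f -> inj g -> apical T -> apical U -> f 28 = g 28 ->
  img f (base T) = img g (base U) -> cp f T = cp g U.
Proof.
move=> fI gI rT rU E28 E; apply: sorted_ext; rewrite ?sorted_cp // => x.
have := mem_base T x fI; rewrite E mem_base //.
case: (eqVneq x (f 28)) => [->|N]; rewrite -?E28 ?N ?andbT // => _.
by rewrite {2}E28 !cp_inE // !apexE rT rU.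
Qed.

(** As [e] ranges over everything outside the finite [S], a copy already present in [F] is excluded
    too. *)
Definition no_threat (F S : seq (seq nat)) : Prop :=
  forall e g, e \notin S -> ~ copy g (e :: F).

(* The first player, forced to claim edge [T] of the copy [f] at a fresh apex, can
   use it as an apical edge of his own only if he has a core with the same trace
   off the apex; the edge he then threatens has to be [37 - T], the one just
   claimed by his opponent. *)
Definition opt_good (f : nat -> nat) (T : nat) (F : seq (seq nat)) : Prop :=
  forall g U, core g F -> apical U -> img g (base U) = img f (base T) ->
    img g (base (37 - U)) = img f (base (37 - T)).

Lemma isz_base f : inj f -> isz (img f (base 18)) (img f (base 19)) = 2.
Proof.
move=> fI; rewrite isz_img // => v w.
by rewrite !mem_cat => /orP[]/base_lt28 lt_v /orP[]/base_lt28 lt_w; apply: fI; lia.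
Qed.

Lemma base_hub T : apical T -> {subset base T <= hub}.
Proof. by case/orP => /eqP->; apply/allP. Qed.

(** After the exchange of the twins, equal traces meet in 3 vertices and opposite ones in 1, whereas
    the two original traces meet in 2. *)
Lemma isz_swap T U : apical T -> apical U ->
  isz (base T) (map swap (base U)) != 2.
Proof. by case/orP=> /eqP-> /orP[]/eqP->. Qed.

(** If both choices failed, two cores in [F] would have traces equal to those of 18 and 19 under
    [f], which meet in 2 vertices. Cores with swapped twins give 1 or 3 instead. Otherwise the
    traces of the two cores coincide, so [U] and [W] are opposite, and the partner trace of [g] is
    the one required: 18 had not failed. *)
Lemma opt_good_exists f F : inj f ->
  (forall g h, core g F -> core h F -> twin_rel g h) ->
  opt_good f 18 F \/ opt_good f 19 F.
Proof.
move=> fI tw; case: (classic (opt_good f 18 F)) => [|N18]; first by left.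
case: (classic (opt_good f 19 F)) => [|N19]; first by right.
case: N18 => g U gF rU EU; case: (eqVneq (img g (base (37 - U)))
  (img f (base (37 - 18)))) => // NU; case: N19 => h W hF rW EW.
have [gI _] := gF; have [hI _] := hF.
have I2 : isz (img g (base U)) (img h (base W)) = 2 by rewrite EU EW isz_base.
case: (tw h g hF gF) => Eh; last first.
  have Ehg : img h (base W) = img g (map swap (base W)).
    rewrite /img -map_comp; congr sort; apply/eq_in_map => v vW.
    by rewrite Eh //; exact: base_hub vW.
  have := isz_swap rU rW; rewrite -I2 Ehg isz_img ?eqxx //.
  have lt_B v : v \in base U ++ map swap (base W) -> v < 29.
    rewrite mem_cat => /orP[/base_lt28|/mapP[i /base_lt28]]; first lia.
    by case: i => [|[|i]] lt_i -> //; rewrite /swap /=; lia.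
  by move=> v w /lt_B lt_v /lt_B lt_w; exact: gI.
have Ehg V : apical V -> img h (base V) = img g (base V).
  by move=> rV; apply: eq_img => v /(base_hub rV)/Eh.
rewrite !Ehg ?apical_opp // in EW *.
case: (eqVneq U W) => [UW|/(apical_neq rU rW) WU].
  move: I2; rewrite Ehg // -UW EU isz_img // => v w.
  by rewrite !mem_cat !orbb => /base_lt28 lt_v /base_lt28 lt_w; apply: fI; lia.
by rewrite -WU EW eqxx in NU.
Qed.

(* In [attack_ready] the second player is to move; in [attack_open] he has just
   claimed [37 - T] at a fresh apex and the first player is to move. *)
Definition attack_ready (F S : seq (seq nat)) : Prop := exists f T,
  [/\ apical T, core f S, no_threat F S & opt_good f T F].

Definition attack_open (F S : seq (seq nat)) : Prop := exists f T,
  [/\ apical T, inj f, (forall j, j < 20 -> j != T -> cp f j \in S),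
      no_threat F S & opt_good f T F] /\
  [/\ cp f T \notin F, cp f T \notin S & forall x, x \in F -> f 28 \notin x].

Lemma bound (L : seq (seq nat)) :
  exists N, forall x v, x \in L -> v \in x -> v < N.
Proof.
exists (foldr maxn 0 (flatten L)).+1 => x v xL vx.
have: v \in flatten L by apply/flattenP; exists x.
elim: (flatten L) => //= w s IHs; rewrite in_cons => /predU1P[->|/IHs]; lia.
Qed.

Lemma bound3 (F S : seq (seq nat)) (f : nat -> nat) : exists N,
  [/\ forall x v, x \in F -> v \in x -> v < N,
      forall x v, x \in S -> v \in x -> v < N
    & forall v, v < 29 -> f v < N].
Proof.
have [N H] := bound (map f (iota 0 29) :: F ++ S); exists N; split.
- by move=> x v xF; apply: H; rewrite in_cons mem_cat xF orbT.
- by move=> x v xS; apply: H; rewrite in_cons mem_cat xS !orbT.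
- by move=> v lt_v; apply: (H _ _ (mem_head _ _)); rewrite map_f // mem_iota.
Qed.

(** Moving the apex to a vertex beyond everything played keeps the core and makes both apical edges
    available; claiming [37 - T] turns [T] into a threat. *)
Lemma ready_play F S : attack_ready F S ->
  exists y, [/\ edgeK 5 y, y \notin F, y \notin S & attack_open F (y :: S)].
Proof.
case=> f [T [rT [fI fS] nt og]].
have [N [NF NS Nf]] := bound3 F S f.
have gI : inj (upd f N).
  by apply: inj_upd => // v lt_v E; have := Nf v; rewrite E ltnn; lia.
set g := upd f N in gI.
have gN U : apical U -> N \in cp g U.
  by move=> rU; apply/cpP; exists 28; rewrite ?apexE.
have nF U : apical U -> cp g U \notin F.
  by move=> /gN NU; apply/negP => /NF/(_ NU); rewrite ltnn.
have nS U : apical U -> cp g U \notin S.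
  by move=> /gN NU; apply/negP => /NS/(_ NU); rewrite ltnn.
have rT' := apical_opp rT.
exists (cp g (37 - T)); split; rewrite ?nF ?nS ?cp_edge ?(apical_lt rT') //.
exists g, T; split; split=> //.
- move=> j lt_j jT; rewrite in_cons; case: (boolP (apical j)) => rj.
    by rewrite (@apical_neq T j) ?eqxx // eq_sym.
  by rewrite cp_upd ?fS ?orbT ?(nonapical_core lt_j).
- by move=> e h; rewrite in_cons negb_or => /andP[_ eS]; exact: nt.
- have E : forall v, v < 28 -> g v = f v by exact: upd_lt.
  by move=> h U hc rU; rewrite !(base_eq _ E); exact: og.
- exact: nF.
- rewrite in_cons negb_or nS // andbT; apply: contra (apical_opp_neq rT).
  by move=> /eqP/(cp_inj gI (apical_lt rT) (apical_lt rT'))/eqP; rewrite eq_sym.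
- by move=> x /NF xF; apply/negP => /xF; rewrite /g /upd eqxx ltnn.
Qed.

Lemma open_no_copy F S x : attack_open F S -> x \notin S -> forall g, ~ copy g (x :: F).
Proof. by case=> f [T [[_ _ _ nt _] _]] xS g; exact: nt. Qed.

Lemma other_core_edge j v : v < 28 -> exists2 k, k < 18 & (k != j) && (v \in ed k).
Proof.
move=> lt_v; have [||k] := @notin_subset [:: j] (inc 18 v).
- by rewrite filter_uniq ?iota_uniq.
- exact: core_degree_ge2.
rewrite mem_filter mem_iota inE => /andP[vk /= lt_k] kj.
by exists k; rewrite // kj.
Qed.

Lemma degree_le (L : seq (seq nat)) f v n : inj f -> n <= 20 ->
  (forall j, j < n -> v \in ed j -> cp f j \in L) -> size (inc n v) <= size L.
Proof. by move=> fI le_n H; apply: cp_filter_size fI le_n H. Qed.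

Lemma open_forced F S f T : apical T -> inj f ->
  (forall j, j < 20 -> j != T -> cp f j \in S) ->
  no_threat F S -> opt_good f T F -> cp f T \notin S ->
  (forall x, x \in F -> f 28 \notin x) -> attack_ready (cp f T :: F) S.
Proof.
move=> rT fI fS nt og xS fr; set x := cp f T in xS *.
have zx : f 28 \in x by rewrite cp_inE // apexE.
(* A core cannot use the forced edge: each of its vertices lies in a second core edge, while no
   older edge of the first player passes through the fresh apex. *)
have coreF g : core g (x :: F) -> core g F.
  case=> gI gx; split=> // j lt_j; have := gx j lt_j.
  rewrite in_cons => /predU1P[E|//]; exfalso.
  move: zx; rewrite -E => /cpP[v vj Ev].
  have [k lt_k /andP[kj vk]] := other_core_edge j (core_lt28 lt_j vj).
  have zk : f 28 \in cp g k by rewrite Ev; apply/cpP; exists v.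
  have := gx k lt_k; rewrite in_cons -E => /predU1P[/cp_inj|/fr].
    by move=> /(_ gI) Ek; move: kj; rewrite Ek ?eqxx //; lia.
  by rewrite zk.
exists f, T; split=> //.
- by split=> // j lt_j; apply: fS; [lia|apply: contraTneq lt_j => ->;
    case/orP: rT => /eqP->].
- move=> e g eS [gI gc].
  case: (boolP (has (fun j => cp g j == x) (iota 0 20))); last first.
    move=> /hasPn N; apply: (nt e g eS); split=> // j lt_j.
    have := gc j lt_j; have := N j; rewrite mem_iota => /(_ lt_j) Nj.
    by rewrite !in_cons (negbTE Nj).
  case/hasP => j0; rewrite mem_iota => /= lt_j0 /eqP E0.
  move: (zx); rewrite -E0 => /cpP[v vj Ev].
  have D j : j < 20 -> v \in ed j -> cp g j \in [:: e; x].
    move=> lt_j vj'; have := gc j lt_j; rewrite !inE orbA => /orP[//|/fr].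
    by rewrite Ev (cp_inE _ gI (ed_lt vj)) vj'.
  (* Only [e] and [x] can pass through [v], and the apex is the only vertex of degree 2. *)
  have v28 : v = 28.
    have := degree_le gI (leqnn 20) D => /= le2.
    have := @degree_ge3 v; have := ed_lt vj; lia.
  subst v; have r0 : apical j0 by rewrite -apexE.
  have r0' := apical_opp r0.
  have E1 : cp g (37 - j0) = e.
    have := D (37 - j0) (apical_lt r0'); rewrite apexE !inE => /(_ r0').
    case/predU1P => [//|/eqP]; rewrite -E0 => /cp_inj -/(_ gI (apical_lt r0') lt_j0).
    by move/eqP; rewrite (negbTE (apical_opp_neq r0)).
  have gcore : core g F.
    apply: coreF; split=> // j lt_j; have := gc j; rewrite in_cons -E1.
    case/(_ _)/predU1P => [|/cp_inj|//]; first lia.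
    move=> /(_ gI) -/(_ _ _)E; have := core_nonapical lt_j.
    by rewrite E ?r0' ?(apical_lt r0') //; lia.
  (* By the choice of [T], the edge still missing is one that the second player already owns. *)
  have Eb := og g j0 gcore r0 (base_cp gI fI (esym Ev) E0).
  move/negP: eS; apply; rewrite -E1 (cp_base gI fI r0' (apical_opp rT) (esym Ev) Eb).
  by apply: fS; rewrite ?(apical_lt (apical_opp rT)) ?apical_opp_neq.
- by move=> g U /coreF; exact: og.
Qed.

(** * Threats of the first player *)

(* An apical edge [x] at the apex [z] whose partner has been blocked. *)
Definition pendant_at f (S : seq (seq nat)) T z x : Prop :=
  [/\ apical T, inj (upd f z), x = cp (upd f z) T & cp (upd f z) (37 - T) \in S].

Definition pendant f (S : seq (seq nat)) x : Prop :=
  exists T z, pendant_at f S T z x.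

(** Each blocked threat leaves one pendant, so pendants accumulate at various apexes over the same
    core. *)
Definition threat_position f (F S : seq (seq nat)) : Prop :=
  [/\ core f F,
      forall x, x \in F -> (exists2 j, j < 18 & x = cp f j) \/ pendant f S x
    & forall x, x \in F -> x \notin S].

(** Used to show that no copy or core contains two pendants. The apex of a pendant lies in no other
    edge of [F], so its degree is at most 3 in a copy using two further edges, and at most 2 in a
    core using one: just below the thresholds 4 and 3. *)
Lemma pair_degree n d j k : (n, d) \in [:: (20, 4); (18, 3)] -> j < n -> k < n ->
  isz (ed j) (ed k) = 2 ->
  forall v w, v \in ed j -> v \notin ed k -> w \in ed k -> w \notin ed j ->
  (d <= size (inc n v)) || (d <= size (inc n w)).
Proof.
move=> nd lt_j lt_k I2 v w vj vk wk wj.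
have H : all (fun nd => all (fun j => all (fun k => (isz (ed j) (ed k) == 2) ==>
    (all (fun v => (v \notin ed k) ==> (nd.2 <= size (inc nd.1 v))) (ed j) ||
     all (fun v => (v \notin ed j) ==> (nd.2 <= size (inc nd.1 v))) (ed k)))
  (iota 0 nd.1)) (iota 0 nd.1)) [:: (20, 4); (18, 3)] by vm_compute.
have := iota_all (iota_all (allP H _ nd) lt_j) lt_k; rewrite /= I2 /=.
case/orP => /allP H1.
  by rewrite (implyP (H1 v vj) vk).
by rewrite (implyP (H1 w wk) wj) orbT.
Qed.

(** Such a vertex is still determined when two core edges are lost, and it shows that an apical edge
    cannot stand in for the core edge [j]. *)
Lemma strong_vertex j T : j < 18 -> apical T -> exists v,
  [/\ v \in ed j, v \notin ed T, 3 <= size (inc 18 v)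
    & forall w, w < 29 -> w != v -> 3 <= size (sdiff 18 v w)].
Proof.
have H : all (fun T => all (fun j => has (fun v =>
    [&& v \notin ed T, 3 <= size (inc 18 v)
    & all (fun w => (w != v) ==> (3 <= size (sdiff 18 v w))) (iota 0 29)]) (ed j))
  (iota 0 18)) [:: 18; 19] by vm_compute.
move=> lt_j rT; have T_in : T \in [:: 18; 19] by rewrite !inE.
have /hasP[v vj /and3P[vT dv H1]] := iota_all (allP H _ T_in) lt_j.
exists v; split; [exact: vj|exact: vT|exact: dv|move=> w lt_w].
exact: (implyP (iota_all H1 lt_w)).
Qed.

Lemma cp_in_size g n L : inj g -> n <= 20 ->
  size [seq j <- iota 0 n | cp g j \in L] <= size L.
Proof. by move=> gI le_n; apply: (cp_filter_size gI le_n) => j _. Qed.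

Lemma size_cons_le (T : Type) (a : T) s n : size s <= n -> size (a :: s) <= n.+1.
Proof. by []. Qed.

Lemma apex_eq v : v < 29 -> 28 <= v -> v = 28.
Proof. by move=> lt_v ge_v; apply/eqP; rewrite eqn_leq ge_v andbT. Qed.

Section ThreatPhase.
Variables (f : nat -> nat) (F S : seq (seq nat)).
Hypothesis tb : threat_position f F S.

Lemma apex_new T z x v : pendant_at f S T z x -> v < 28 -> f v <> z.
Proof.
case=> _ uI _ _ lt_v E; have: v = 28; last by lia.
by apply: uI => //; [lia|rewrite upd_lt // /upd eqxx].
Qed.

Lemma apex_in T z x : pendant_at f S T z x -> z \in x.
Proof.
by case=> rT _ -> _; apply/cpP; exists 28; rewrite ?apexE // /upd eqxx.
Qed.

(** Core edges of [f] avoid [z], and a pendant through [z] has its apex there. If it were of the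
    opposite type, it would be the blocked partner of [p]. *)
Lemma pendant_uniq T z p x :
  p \in F -> x \in F -> pendant_at f S T z p -> z \in x -> x = p.
Proof.
have [_ cl dis] := tb; move=> pF xF pp zx.
case: (cl x xF) => [[j lt_j E]|[U [y pU]]].
  move: zx; rewrite E => /cpP[v vj Ez].
  by case: (apex_new pp (core_lt28 lt_j vj)).
have [rU uI Ex _] := pU; have [rT _ Ep pS] := pp.
move: zx; rewrite Ex => /cpP[v vU].
case: (ltnP v 28) => [lt_v|ge_v] Ez.
  by case: (apex_new pp lt_v); rewrite Ez upd_lt.
have v28 := apex_eq (ed_lt vU) ge_v.
move: Ez; rewrite v28 /upd eqxx -/(upd f _) => Ez.
case: (eqVneq T U) => [<-|/(apical_neq rT rU) UT]; first by rewrite Ep Ez.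
by have := dis x xF; rewrite Ex UT -Ez pS.
Qed.

Lemma pendant_pair T z p U y q g j k :
  p \in F -> q \in F -> pendant_at f S T z p -> pendant_at f S U y q -> p != q ->
  inj g -> j < 20 -> k < 20 -> cp g j = p -> cp g k = q ->
  isz (ed j) (ed k) = 2 /\ exists v w,
    [/\ v \in ed j, v \notin ed k & g v = z] /\
    [/\ w \in ed k, w \notin ed j & g w = y].
Proof.
move=> pF qF pp pq N gI lt_j lt_k Ej Ek.
have zq : z \notin q.
  by apply/negP => /(pendant_uniq pF qF pp) E; rewrite E eqxx in N.
have yp : y \notin p.
  by apply/negP => /(pendant_uniq qF pF pq) E; rewrite E eqxx in N.
split; last first.
  have := apex_in pp; rewrite -Ej => /cpP[v vj Ev].
  have := apex_in pq; rewrite -Ek => /cpP[w wk Ew].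
  exists v, w; split; split=> //.
    by apply: contraNN zq => vk; rewrite -Ek Ev; apply/cpP; exists v.
  by apply: contraNN yp => wj; rewrite -Ej Ew; apply/cpP; exists w.
(* Both apexes are needed at once, so the extra vertex 29 stands for the second one. *)
pose h v := if v == 29 then y else upd f z v.
pose s := map (fun v => if v == 28 then 29 else v) (ed U).
have [rT uI Ep _] := pp; have [rU uJ Eq _] := pq.
have zy : z <> y by move=> E; move: zq; rewrite E (apex_in pq).
have hI v w : v < 30 -> w < 30 -> h v = h w -> v = w.
  rewrite /h; case: (eqVneq v 29) => [->|Nv]; case: (eqVneq w 29) => [->|Nw] //.
  - move=> _ lt_w; rewrite /upd; case: (eqVneq w 28) => [_ /esym//|N28 /esym].
    by move/(apex_new pq); case; lia.
  - move=> lt_v _; rewrite /upd; case: (eqVneq v 28) => [_ //|N28].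
    by move/(apex_new pq); case; lia.
  - by move=> lt_v lt_w; apply: uI; lia.
have Ep' : p = img h (ed T).
  rewrite Ep; apply: eq_img => v /ed_lt lt_v; rewrite /h; case: eqP => //; lia.
have Eq' : q = img h s.
  rewrite Eq /cp /img /s -map_comp; congr sort; apply/eq_in_map => v /ed_lt lt_v.
  rewrite /= /h /upd; case: (eqVneq v 28) => [_|N28] //=.
  by rewrite (negbTE N28); case: eqP => //; lia.
have E : isz p q = isz (ed T) s.
  rewrite Ep' Eq' isz_img // => v w vB wB; apply: hI.
    move: vB; rewrite mem_cat => /orP[/ed_lt|/mapP[i /ed_lt]]; first lia.
    by move=> lt_i ->; case: ifP => //; lia.
  move: wB; rewrite mem_cat => /orP[/ed_lt|/mapP[i /ed_lt]]; first lia.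
  by move=> lt_i ->; case: ifP => //; lia.
have jk : j != k by apply: contraNneq N => E1; rewrite -Ej -Ek E1.
(* Pendants of the same type would meet in 4 vertices, too many for two edges of a copy; opposite
   types meet in 2. *)
have := isz_le3 lt_j lt_k jk; rewrite -(isz_cp _ _ gI) Ej Ek E /s.
by case/orP: rT => /eqP->; case/orP: rU => /eqP->.
Qed.

Variables (x : seq nat) (xF : x \notin F).

Lemma pendant_pair_core T z p U y q g j k :
  p \in F -> q \in F -> pendant_at f S T z p -> pendant_at f S U y q ->
  core g (x :: F) -> j < 18 -> k < 18 -> cp g j = p -> cp g k = q -> p = q.
Proof.
move=> pF qF pp pq [gI gc] lt_j lt_k Ej Ek; case: (eqVneq p q) => // N.
have lt_j' : j < 20 by exact: leq_trans lt_j _.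
have lt_k' : k < 20 by exact: leq_trans lt_k _.
have [I2 [v [w [[vj vk Ev] [wk wj Ew]]]]] :=
  pendant_pair pF qF pp pq N gI lt_j' lt_k' Ej Ek.
have D u T' z' p' : p' \in F -> pendant_at f S T' z' p' -> u < 29 -> g u = z' ->
    size (inc 18 u) <= 2.
  move=> p'F pp' lt_u Eu; apply: (@degree_le [:: x; p'] g) => // i lt_i ui.
  have := gc i lt_i; rewrite !inE => /predU1P[->|iF]; first by rewrite eqxx.
  rewrite (pendant_uniq p'F iF pp') ?eqxx ?orbT // -Eu.
  by apply/cpP; exists u.
have := @pair_degree 18 3 j k isT lt_j lt_k I2 v w vj vk wk wj.
have Dv := D v _ _ _ pF pp (ed_lt vj) Ev.
have Dw := D w _ _ _ qF pq (ed_lt wk) Ew.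
by case/orP => /leq_trans H; [have := H _ Dv|have := H _ Dw].
Qed.

(** If [g] uses no pendant, only [x] is foreign and one lost edge is affordable. Otherwise a single
    core edge [j0] is a pendant; rigidity off [j0] and [x] fixes a strong vertex of [j0], which the
    pendant does not contain. *)
Lemma threat_position_core g : core g (x :: F) -> twin_rel g f.
Proof.
move=> gF; have [gI gc] := gF; have [[fI fF] cl dis] := tb.
pose isP j := exists T z, cp g j \in F /\ pendant_at f S T z (cp g j).
case: (classic (exists2 j, j < 18 & isP j)) => [[j0 lt_j0 [T [z [j0F pp]]]]|N];
    last first.
  apply: (@core_twin_rel g f [seq j <- iota 0 18 | cp g j \in [:: x]]) => //.
    exact: (@cp_in_size g 18 [:: x] gI isT).
  move=> j lt_j; rewrite mem_filter mem_iota lt_j /= andbT inE => jx.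
  have := gc j lt_j; rewrite in_cons (negbTE jx) => /= jF.
  case: (cl _ jF) => [[k lt_k E]|[T [z pp]]]; first by
    exists k => //; exact: leq_trans lt_k _.
  by case: N; exists j => //; exists T, z.
pose R := [seq j <- iota 0 18 | cp g j \in [:: x]]; pose Q := j0 :: R.
have szQ : size Q <= 2.
  by apply: size_cons_le; exact: (@cp_in_size g 18 [:: x] gI isT).
have A := @rigid_cp g f 18 Q gI fI isT szQ.
have {A}A : forall j, j < 18 -> j \notin Q -> cp g j = cp f j.
  apply: A => j lt_j.
  rewrite in_cons negb_or mem_filter mem_iota lt_j /= andbT inE => /andP[jj0 jx].
  have := gc j lt_j; rewrite in_cons (negbTE jx) => /= jF.
  case: (cl _ jF) => [[k lt_k E]|[U [y pq]]]; first by
    exists k => //; exact: leq_trans lt_k _.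
  have := pendant_pair_core j0F jF pp pq gF lt_j0 lt_j erefl erefl.
  move/cp_inj => E; rewrite E ?eqxx // in jj0; exact: leq_trans _ (isT : 18 <= 20).
have [rT uI Ep _] := pp.
have [v [vj vT dv sv]] := strong_vertex lt_j0 rT.
have Ev : g v = f v.
  apply: (vertex_agree gI fI A).
    by apply: inc_notin; exact: leq_ltn_trans szQ dv.
  by move=> w lt_w wv; exact: leq_ltn_trans szQ (sv w lt_w wv).
have: g v \in cp g j0 by apply/cpP; exists v.
have lt_v := core_lt28 lt_j0 vj.
rewrite Ep Ev -(upd_lt f z lt_v) cp_inE ?(negbTE vT) //; lia.
Qed.

Variables (e : seq nat) (eF : e \notin F) (xS : x \notin S) (eS : e \notin S).

Lemma pendant_pair_copy T z p U y q g j k :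
  p \in F -> q \in F -> pendant_at f S T z p -> pendant_at f S U y q ->
  copy g [:: e, x & F] -> j < 20 -> k < 20 -> cp g j = p -> cp g k = q -> p = q.
Proof.
move=> pF qF pp pq [gI gc] lt_j lt_k Ej Ek; case: (eqVneq p q) => // N.
have [I2 [v [w [[vj vk Ev] [wk wj Ew]]]]] :=
  pendant_pair pF qF pp pq N gI lt_j lt_k Ej Ek.
have D u T' z' p' : p' \in F -> pendant_at f S T' z' p' -> u < 29 -> g u = z' ->
    size (inc 20 u) <= 3.
  move=> p'F pp' lt_u Eu; apply: (@degree_le [:: e; x; p'] g) => // i lt_i ui.
  have := gc i lt_i; rewrite !inE orbA => /orP[/orP[]->|iF]; rewrite ?orbT //.
  rewrite (pendant_uniq p'F iF pp') ?eqxx ?orbT // -Eu.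
  by apply/cpP; exists u.
have := @pair_degree 20 4 j k isT lt_j lt_k I2 v w vj vk wk wj.
have Dv := D v _ _ _ pF pp (ed_lt vj) Ev.
have Dw := D w _ _ _ qF pq (ed_lt wk) Ew.
by case/orP => /leq_trans H; [have := H _ Dv|have := H _ Dw].
Qed.

(** By rigidity, a copy using a pendant at [z] is [f] with its apex moved to [z], and it needs the
    blocked partner. Without pendants, all edges taken from [F] are core edges of [f], so the two
    new edges are the apical ones and only the apex can differ. *)
Lemma threat_position_threat g : copy g [:: e, x & F] ->
  [/\ forall v, v < 28 -> g v = f v, cp g 18 \in [:: e; x] & cp g 19 \in [:: e; x]].
Proof.
move=> gF; have [gI gc] := gF; have [[fI fF] cl dis] := tb.
pose Q := [seq j <- iota 0 20 | cp g j \in [:: e; x]].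
have szQ : size Q <= 2 by exact: (cp_in_size [:: e; x] gI (leqnn 20)).
have inQ j : j < 20 -> (j \in Q) = (cp g j \in [:: e; x]).
  move=> lt_j; by rewrite mem_filter mem_iota /= lt_j andbT.
have outQ j : j < 20 -> j \notin Q -> cp g j \in F.
  move=> lt_j; rewrite inQ // !inE negb_or => /andP[je jx].
  by have := gc j lt_j; rewrite !in_cons (negbTE je) (negbTE jx).
pose isP j := exists T z, cp g j \in F /\ pendant_at f S T z (cp g j).
case: (classic (exists2 j, j < 20 & isP j)) => [[j0 lt_j0 [T [z [j0F pp]]]]|N].
  have [rT uI Ep pS] := pp.
  have A : forall j, j < 20 -> j \notin Q -> cp g j = cp (upd f z) j.
    apply: (@rigid_cp _ _ 20 Q) => // j lt_j jQ.
    have jF := outQ j lt_j jQ.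
    case: (cl _ jF) => [[k lt_k E]|[U [y pq]]].
      by exists k; [exact: leq_trans lt_k _|rewrite E cp_upd].
    have E := pendant_pair_copy j0F jF pp pq gF lt_j0 lt_j erefl erefl.
    by exists T; rewrite -?E ?apical_lt.
  have j0Q : j0 \notin Q.
    rewrite inQ // !inE negb_or; apply/andP.
    by split; [apply: contraNneq eF|apply: contraNneq xF] => <-.
  have Tj0 : T = j0.
    by apply: (cp_inj uI) => //; rewrite ?apical_lt // -Ep A.
  have [E E28] := agree20 gI uI szQ A.
  have nQ : ~~ ((18 \in Q) && (19 \in Q)).
    by case/orP: rT => /eqP ET; rewrite -Tj0 ET in j0Q; rewrite (negbTE j0Q) ?andbF.
  have Eg v : v < 29 -> g v = upd f z v.
    move=> lt_v; case: (ltnP v 28) => [|ge_v]; first exact: E.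
    by rewrite (apex_eq lt_v ge_v); exact: E28.
  have rT' := apical_opp rT.
  have := gc (37 - T) (apical_lt rT'); rewrite (eq_cp _ Eg) !in_cons.
  case/or3P => [/eqP E1|/eqP E1|/dis]; last by rewrite pS.
    by move: eS; rewrite -E1 pS.
  by move: xS; rewrite -E1 pS.
have cF j : j < 20 -> j \notin Q -> exists2 k, k < 18 & cp g j = cp f k.
  move=> lt_j jQ; have jF := outQ j lt_j jQ.
  case: (cl _ jF) => // [[U [y pq]]].
  by case: N; exists j => //; exists U, y.
have A : forall j, j < 20 -> j \notin Q -> cp g j = cp f j.
  apply: (@rigid_cp _ _ 20 Q) => // j lt_j /(cF j lt_j)[k lt_k E].
  by exists k => //; exact: leq_trans lt_k _.
have QT T : apical T -> T \in Q.
  move=> rT; apply: contraT => TQ; have lt_T := apical_lt rT.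
  have [k lt_k] := cF T lt_T TQ; rewrite A // => /cp_inj E.
  have := core_nonapical lt_k; by rewrite -E ?rT //; exact: leq_trans lt_k _.
split; first by case: (agree20 gI fI szQ A).
  by rewrite -inQ ?QT.
by rewrite -inQ ?QT.
Qed.

End ThreatPhase.

(** * The second player's strategy *)

Definition disjoint_from (F S : seq (seq nat)) : Prop := forall x, x \in F -> x \notin S.

(* In the following positions the first player is to move. *)
Definition building (F S : seq (seq nat)) : Prop := exists f j,
  [/\ inj f, j <= 17, size F = j,
      forall i, i < j -> cp f i \in S
    & forall x, x \in S -> exists2 i, i < j & x = cp f i] /\
  disjoint_from F S /\ (j = 17 -> forall x, x \in F -> f 27 \notin x).

Definition core_built (F S : seq (seq nat)) : Prop :=
  [/\ size F = 18, exists f, core f S & disjoint_from F S].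

Definition core_blocked (F S : seq (seq nat)) : Prop :=
  (exists f, core f S) /\ exists g i,
  [/\ inj g, i < 18, cp g i \in S,
      forall x, x \in F -> exists2 j, j < 20 & x = cp g j
    & disjoint_from F S].

Definition apex_blocked (F S : seq (seq nat)) : Prop :=
  (exists f, core f S) /\ exists g, threat_position g F S.

Definition safe (F S : seq (seq nat)) : Prop :=
  [\/ building F S, core_built F S, core_blocked F S
    | apex_blocked F S \/ (attack_open F S \/ exists g, copy g S)].

Definition reply (F S : seq (seq nat)) : Prop :=
  exists y, [/\ edgeK 5 y, y \notin F, y \notin S & safe F (y :: S)].

Lemma core_cons f y S : core f S -> core f (y :: S).
Proof. by case=> fI fS; split=> // j /fS H; rewrite in_cons H orbT. Qed.

Lemma disjoint_cons F S x y : disjoint_from F S -> x \notin S ->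
  y \notin x :: F -> disjoint_from (x :: F) (y :: S).
Proof.
move=> dis xS yF z zF; rewrite in_cons negb_or; apply/andP; split.
  by apply: contraNneq yF => <-.
by move: zF; rewrite in_cons => /predU1P[->|/dis].
Qed.

Lemma ready_reply F S : attack_ready F S -> reply F S.
Proof.
case/ready_play=> y [ey yF yS pw]; exists y; split=> //.
by constructor 4; right; left.
Qed.

(** With no threat to parry, the perpetual attack starts in whichever order is safe. *)
Lemma calm_reply F S : (exists f, core f S) -> no_threat F S ->
  (forall g h, core g F -> core h F -> twin_rel g h) -> reply F S.
Proof.
case=> f fS nt tw; apply: ready_reply.
by case: (opt_good_exists fS.1 tw) => og; exists f; [exists 18|exists 19].
Qed.

Lemma threat_cases F S : no_threat F S \/
  exists e g, e \notin S /\ copy g (e :: F).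
Proof.
case: (classic (exists e g, e \notin S /\ copy g (e :: F))) => H; [by right|left].
by move=> e g eS ge; apply: H; exists e, g.
Qed.

Lemma copy_sub g (F G : seq (seq nat)) : {subset F <= G} -> copy g F -> copy g G.
Proof. by move=> FG [gI gF]; split=> // j /gF/FG. Qed.

Lemma subset_dup (T : eqType) (x : T) s : x \in s -> {subset x :: s <= s}.
Proof. by move=> xs y; rewrite in_cons => /predU1P[->|]. Qed.

Lemma inj_ext f g : (forall v, v < 29 -> f v = g v) -> inj f -> inj g.
Proof.
by move=> E fI i k lt_i lt_k; rewrite -!E //; apply: fI.
Qed.

(** A threat forces [x] and [e] to be the two apical edges at a common apex; claiming [e] turns [x]
    into one more pendant, and the position keeps its form. *)
Lemma apex_blocked_step F S x : apex_blocked F S -> x \notin F -> x \notin S ->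
  (forall g, ~ copy g (x :: F)) /\ reply (x :: F) S.
Proof.
move=> [fS [f tb]] xF xS; have nc g : ~ copy g (x :: F).
  (* Taking [e] to be [x] makes both apical edges equal to [x], which is absurd. *)
  move=> gF; have gF2 : copy g [:: x, x & F].
    by apply: copy_sub gF => y yF; rewrite in_cons yF orbT.
  have [_] := threat_position_threat tb xF xF xS xS gF2.
  rewrite !inE !orbb => /eqP E18 /eqP E19.
  by have := cp_inj gF.1 (isT : 18 < 20) (isT : 19 < 20); rewrite E18 E19 => /(_ erefl).
split=> //; case: (threat_cases (x :: F) S) => [nt|[e [g [eS ge]]]].
  apply: calm_reply => // g h gF hF.
  exact: (twin_rel_trans (threat_position_core tb xF gF) (threat_position_core tb xF hF)).
have eF : e \notin x :: F.
  by apply/negP => /subset_dup eF; case: (nc g); apply: copy_sub ge.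
have [eF' ex] : e \notin F /\ x != e.
  by move: eF; rewrite in_cons negb_or => /andP[]; rewrite eq_sym.
have [Eg e18 e19] := threat_position_threat tb xF eF' xS eS ge.
have [gI _] := ge.
have N : cp g 18 <> cp g 19 by move/(cp_inj gI) => /(_ isT isT).
have [T [rT ET ET']] : exists T, [/\ apical T, cp g T = e & cp g (37 - T) = x].
  move: e18 e19; rewrite !inE => /orP[]/eqP E18 /orP[]/eqP E19;
    by [rewrite E18 E19 in N|exists 18|exists 19].
have Eu v : v < 29 -> g v = upd f (g 28) v.
  rewrite /upd => lt_v; case: eqP => [->//|Nv]; apply: Eg; move/eqP: Nv lt_v; clear; lia.
exists e; split=> //.
  by rewrite -ET cp_edge ?apical_lt.
constructor 4; left; split; first by case: fS => h hS; exists h; exact: core_cons.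
have [fF cl dis] := tb.
exists f; split; [exact: core_cons| |exact: disjoint_cons].
move=> y; rewrite in_cons => /predU1P[->|/cl[]].
- right; exists (37 - T), (g 28); split.
  + exact: apical_opp.
  + exact: inj_ext Eu gI.
  + by rewrite -ET'; exact: eq_cp.
  + by rewrite apical_oppK // -(eq_cp _ Eu) ET mem_head.
- by left.
- move=> [U [z [rU uI Ey Sy]]]; right; exists U, z; split=> //.
  by rewrite in_cons Sy orbT.
Qed.

(** By rigidity, a threatening copy agrees with [f] off the apex, so it contains the core edge
    [cp f i] owned by the second player. Thus there is no threat and the attack starts. *)
Lemma core_blocked_step F S x : core_blocked F S -> x \notin F -> x \notin S ->
  (forall g, ~ copy g (x :: F)) /\ reply (x :: F) S.
Proof.
move=> [fS [f [i [fI lt_i iS cl dis]]]] xF xS.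
have nt : no_threat (x :: F) S.
  move=> e g eS [gI gF]; pose Q := [seq j <- iota 0 20 | cp g j \in [:: e; x]].
  have szQ : size Q <= 2 by exact: (@cp_in_size g 20 [:: e; x] gI isT).
  have inQ j : j < 20 -> (j \in Q) = (cp g j \in [:: e; x]).
    by move=> lt_j; rewrite mem_filter mem_iota /= lt_j andbT.
  have outQ j : j < 20 -> j \notin Q -> cp g j \in F.
    move=> lt_j; rewrite inQ // !inE negb_or => /andP[je jx].
    by have := gF j lt_j; rewrite !in_cons (negbTE je) (negbTE jx).
  have A : forall j, j < 20 -> j \notin Q -> cp g j = cp f j.
    by apply: (@rigid_cp _ _ 20 Q) => // j lt_j /(outQ j lt_j)/cl.
  have lt_i' : i < 20 by exact: leq_trans lt_i _.
  have iQ : i \in Q.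
    apply: contraT => iQ; have := outQ i lt_i' iQ.
    by rewrite A // => /dis; rewrite iS.
  have [E E28] := agree20 gI fI szQ A.
  have : cp g i \in [:: e; x] by rewrite -inQ.
  rewrite (eq_cp_core E lt_i) !inE => /orP[]/eqP E1.
    by rewrite -E1 iS in eS.
  by rewrite -E1 iS in xS.
split; first by move=> g gF; apply: (nt x g) => //;
  apply: copy_sub gF => y yF; rewrite in_cons yF orbT.
apply: calm_reply => // g h gF hF.
have tw k : core k (x :: F) -> twin_rel k f.
  move=> [kI kF]; apply: (@core_twin_rel k f
    [seq j <- iota 0 18 | cp k j \in [:: x]]) => //.
    exact: (@cp_in_size k 18 [:: x] kI isT).
  move=> j lt_j; rewrite mem_filter mem_iota /= lt_j andbT inE => jx.
  by have := kF j lt_j; rewrite in_cons (negbTE jx) => /cl.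
exact: (twin_rel_trans (tw g gF) (tw h hF)).
Qed.

(** Two cores of 18 edges among 19 differ in at most one edge. *)
Lemma core_pair_twin F g h : size F = 19 -> core g F -> core h F -> twin_rel g h.
Proof.
move=> szF [gI gF] [hI hF].
pose Q := [seq j <- iota 0 18 | cp g j \notin map (cp h) (iota 0 18)].
have U : uniq (map (cp g) Q ++ map (cp h) (iota 0 18)).
  rewrite cat_uniq (cp_filter_uniq _ gI) //.
  have := @cp_filter_uniq h 18 predT hI isT; rewrite filter_predT => ->.
  rewrite andbT; apply/hasPn => x xh; apply/mapP => -[j].
  by rewrite mem_filter => /andP[N _] E; rewrite -E xh in N.
apply: (@core_twin_rel g h Q) => //.
  have: size (map (cp g) Q ++ map (cp h) (iota 0 18)) <= size F.
    apply: uniq_leq_size U _ => x; rewrite mem_cat => /orP[]/mapP[j].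
      by rewrite mem_filter mem_iota => /andP[_ /= lt_j] ->; exact: gF.
    by rewrite mem_iota => /= lt_j ->; exact: hF.
  by rewrite size_cat !size_map size_iota szF -[19]/(1 + 18) leq_add2r.
move=> j lt_j; have ji : j \in iota 0 18 by rewrite mem_iota.
rewrite mem_filter ji andbT negbK => /mapP[k].
by rewrite mem_iota => /= lt_k ->; exists k => //; exact: leq_trans lt_k _.
Qed.

Lemma core_built_step F S x : core_built F S -> x \notin F -> x \notin S ->
  (forall g, ~ copy g (x :: F)) /\ reply (x :: F) S.
Proof.
move=> [szF fS dis] xF xS.
have nc g : ~ copy g (x :: F) by move/copy_size; rewrite /= szF.
split=> //; case: (threat_cases (x :: F) S) => [nt|[e [g [eS ge]]]].
  by apply: calm_reply => // g h; apply: core_pair_twin; rewrite /= szF.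
have eF : e \notin x :: F.
  by apply/negP => /subset_dup eF; case: (nc g); apply: copy_sub ge.
have [gI gF] := ge.
(* The first player has only 19 edges, so a threat uses all of them: together with [e] they are
   exactly the 20 edges of [g]. *)
have onto y : y \in e :: x :: F -> exists2 j, j < 20 & y = cp g j.
  have U := @cp_filter_uniq g 20 predT gI isT; rewrite filter_predT in U.
  have [||_ <-] := uniq_min_size U (s2 := e :: x :: F).
  - by move=> z /mapP[j]; rewrite mem_iota => /= lt_j ->; exact: gF.
  - by rewrite size_map size_iota /= szF.
  by move=> /mapP[j]; rewrite mem_iota => /= lt_j ->; exists j.
have [i lt_i Ei] := onto e (mem_head _ _).
have fS' : exists f, core f (e :: S) by case: fS => h hS; exists h; exact: core_cons.
have dis' := disjoint_cons dis xS eF.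
have ontoF y : y \in x :: F -> exists2 j, j < 20 & y = cp g j.
  by move=> yF; apply: onto; rewrite in_cons yF orbT.
exists e; split=> //; first by rewrite Ei cp_edge.
case: (boolP (apical i)) => ri; last first.
  constructor 3; split=> //; exists g, i; split=> //.
    exact: nonapical_core.
  by rewrite -Ei mem_head.
constructor 4; left; split=> //; exists g.
have Eu v : v < 29 -> g v = upd g (g 28) v.
  by rewrite /upd; case: eqP => [->|].
split=> //.
  split=> // j lt_j; have lt_j' : j < 20 by exact: leq_trans lt_j _.
  have := gF j lt_j'; rewrite in_cons Ei => /predU1P[/(cp_inj gI lt_j' lt_i) E|//].
  by have := core_nonapical lt_j; rewrite E ri.
move=> y yF; have [j lt_j Ey] := ontoF y yF.
case: (boolP (apical j)) => rj; last by left; exists j => //; exact: nonapical_core.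
right; exists j, (g 28); split=> //.
- exact: inj_ext Eu gI.
- by rewrite Ey; exact: eq_cp.
have ji : j != i by apply: contraNneq eF => E; rewrite Ei -E -Ey.
by rewrite -(eq_cp _ Eu) -(apical_neq rj ri ji) -Ei mem_head.
Qed.

(** Either the first player gives the forced answer and the attack can be renewed, or the second
    player completes his copy. *)
Lemma open_step F S x : attack_open F S -> x \notin F -> x \notin S ->
  (forall g, ~ copy g (x :: F)) /\ reply (x :: F) S.
Proof.
move=> pw xF xS; split; first exact: open_no_copy pw xS.
have [f [T [[rT fI fS nt og] [TF TS fr]]]] := pw.
case: (eqVneq x (cp f T)) => [->|N]; first by apply: ready_reply; exact: open_forced.
exists (cp f T); split=> //.
- by rewrite cp_edge ?apical_lt.
- by rewrite in_cons negb_or eq_sym N.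
constructor 4; right; right; exists f; split=> // j lt_j; rewrite in_cons.
by case: (eqVneq j T) => [->|/(fS j lt_j)->]; rewrite ?eqxx ?orbT.
Qed.

(** * Building the core of the second player *)

Lemma fresh_vertex j : j < 17 -> exists v,
  [/\ v \in ed j, v \notin flatten (take j edges) & j = 16 -> v = 27].
Proof.
have H : all (fun j => has (fun v => (v \notin flatten (take j edges)) &&
   ((j == 16) ==> (v == 27))) (ed j)) (iota 0 17) by vm_compute.
move=> lt_j; have /hasP[v vj /andP[vn Hv]] := iota_all H lt_j.
by exists v; split=> // E; apply/eqP; move: Hv; rewrite E eqxx.
Qed.

Lemma ed_take i j v : i < j -> j < 17 -> v \in ed i -> v \in flatten (take j edges).
Proof.
move=> lt_i lt_j vi; apply/flattenP; exists (ed i) => //.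
rewrite /ed -(nth_take _ lt_i) mem_nth // size_takel //; exact: leq_trans (ltnW lt_j) _.
Qed.

(** Vertices of earlier edges keep their images and all others move beyond the board, so the next
    edge contains an untouched vertex and is available. For edge 16 this vertex is 27, which
    reserves edge 17 until the next move of the first player. *)
Lemma building_early (F S : seq (seq nat)) x f j : inj f -> j < 17 -> size F = j ->
  (forall i, i < j -> cp f i \in S) ->
  (forall x, x \in S -> exists2 i, i < j & x = cp f i) ->
  disjoint_from F S -> x \notin S -> reply (x :: F) S.
Proof.
move=> fI lt_j szF fS Sf dis xS.
have [N [NF NS Nf]] := bound3 (x :: F) S f.
pose g v := if v \in flatten (take j edges) then f v else N + v.
have gI : inj g.
  move=> v w lt_v lt_w; rewrite /g; have := Nf v lt_v; have := Nf w lt_w.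
  case: ifP => _; case: ifP => _ H1 H2 E; try exact: fI.
  - by move: H2; rewrite E ltnNge leq_addr.
  - by move: H1; rewrite -E ltnNge leq_addr.
  - exact: addnI E.
have Eg i : i < j -> cp g i = cp f i.
  by move=> lt_i; apply: eq_img => v vi; rewrite /g (ed_take lt_i lt_j vi).
have [u [uj un u27]] := fresh_vertex lt_j.
have gu : g u = N + u by rewrite /g (negbTE un).
have gy : N + u \in cp g j by rewrite -gu; apply/cpP; exists u.
have Nu (L : seq (seq nat)) : (forall x v, x \in L -> v \in x -> v < N) ->
    cp g j \notin L.
  by move=> H; apply/negP => /H/(_ gy); rewrite ltnNge leq_addr.
have yF := Nu _ NF; have yS := Nu _ NS.
have lt_j20 : j < 20 by exact: leq_trans lt_j _.
exists (cp g j); split=> //; first exact: cp_edge.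
constructor 1; exists g, j.+1; split; first split=> //.
- by rewrite /= szF.
- move=> i; rewrite ltnS leq_eqVlt in_cons => /predU1P[->|lt_i].
    by rewrite eqxx.
  by rewrite Eg // fS ?orbT.
- move=> y; rewrite in_cons => /predU1P[->|/Sf[i lt_i ->]]; first by exists j.
  by exists i; [exact: ltnW|rewrite Eg].
split; first exact: disjoint_cons.
move=> [j16] z zF; rewrite -(u27 j16) gu.
by apply/negP => /(NF z _ zF); rewrite ltnNge leq_addr.
Qed.

Lemma cp_swap f i : i < 17 -> cp (f \o swap) i = cp f i.
Proof.
have H : all (fun i => perm_eq (map swap (ed i)) (ed i)) (iota 0 17) by vm_compute.
move=> lt_i; rewrite /cp /img map_comp.
apply/(perm_sortP leq_total leq_trans anti_leq); apply: perm_map.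
exact: (iota_all H lt_i).
Qed.

Lemma inj_swap f : inj f -> inj (f \o swap).
Proof.
have lt_swap v : v < 29 -> swap v < 29 by case: v => [|[|v]].
move=> fI v w lt_v lt_w /= E; apply: (can_inj swapK).
by apply: fI => //; exact: lt_swap.
Qed.

(** Edge 17 brings no new vertex, but older edges of the first player avoid the image of 27, so only
    his latest move [x] can occupy it. Exchanging the twins then moves edge 17 and keeps the first
    17 edges. *)
Lemma building_step F S x : building F S -> x \notin F -> x \notin S ->
  (forall g, ~ copy g (x :: F)) /\ reply (x :: F) S.
Proof.
move=> [f [j [[fI le_j szF fS Sf] [dis f27]]]] xF xS; split.
  by move=> g /copy_size /=; rewrite szF ltnS => /leq_trans/(_ le_j).
move: le_j; rewrite leq_eqVlt => /predU1P[j17|lt_j]; last first.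
  exact: building_early fI lt_j szF fS Sf dis xS.
subst j.
have [g [gI Eg g27 gx]] : exists g, [/\ inj g, forall i, i < 17 -> cp g i = cp f i,
    g 27 = f 27 & cp g 17 != x].
  case: (eqVneq (cp f 17) x) => [<-|N]; last by exists f.
  exists (f \o swap); split=> //; [exact: inj_swap|exact: cp_swap|].
  apply/eqP => E; have : f 0 \in cp f 17 by rewrite cp_inE.
  rewrite -E => /cpP[v v17 /= /fI]; have := allP (_ : all (fun v => 0 != swap v) (ed 17)).
  move=> /(_ isT v v17); have := ed_lt v17.
  by case: v {v17} => [|[|v]] lt_v N // /(_ isT) E0; have := E0 lt_v.
have yF : cp g 17 \notin F.
  apply/negP => /(f27 j17); rewrite -g27 cp_inE //.
have lt17 i : i < 17 -> i < 20 by move=> lt_i; exact: leq_trans lt_i _.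
have yS : cp g 17 \notin S.
  apply/negP => /Sf[i]; rewrite j17 => lt_i; rewrite -Eg // => /cp_inj E.
  by have E17 := E gI isT (lt17 i lt_i); rewrite -E17 in lt_i.
have yxF : cp g 17 \notin x :: F by rewrite in_cons negb_or gx.
exists (cp g 17); split=> //; first exact: cp_edge.
constructor 2; split; [by rewrite /= j17| |exact: disjoint_cons].
exists g; split=> // i; rewrite ltnS leq_eqVlt in_cons => /predU1P[->|lt_i].
  by rewrite eqxx.
by rewrite Eg // fS ?orbT // j17.
Qed.

(** Once the second player owns a copy, it does not matter whether his opponent completes one
    too. *)
Lemma safe_step F S x : safe F S -> x \notin F -> x \notin S ->
  ((forall g, ~ copy g (x :: F)) \/ exists g, copy g S) /\ reply (x :: F) S.
Proof.
move=> s xF xS; have wk (P Q R : Prop) : P /\ R -> (P \/ Q) /\ R by case; split; [left|].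
case: s => [s|s|s|[s|[s|s]]].
- by apply: wk; exact: building_step s xF xS.
- by apply: wk; exact: core_built_step s xF xS.
- by apply: wk; exact: core_blocked_step s xF xS.
- by apply: wk; exact: apex_blocked_step s xF xS.
- by apply: wk; exact: open_step s xF xS.
split; first by right.
(* The second player already owns a copy, so any unclaimed edge will do. *)
have [N [NF NS _]] := bound3 (x :: F) S id.
have gI : inj (addn N) by move=> v w _ _ /addnI.
have gy : N \in cp (addn N) 0 by rewrite -[X in X \in _]addn0 cp_inE.
exists (cp (addn N) 0); split.
- exact: cp_edge.
- by apply/negP => /NF/(_ gy); rewrite ltnn.
- by apply/negP => /NS/(_ gy); rewrite ltnn.
constructor 4; right; right; case: s => g gS; exists g.
by apply: copy_sub gS => y yS; rewrite in_cons yS orbT.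
Qed.

Lemma safe_nil : safe [::] [::].
Proof. by constructor 1; exists id, 0; split=> //; split. Qed.

(** * Plays *)

Definition drawn_edge (s : seq nat) : {set 'I_29} := [set i : 'I_29 | (i : nat) \in s].

Definition drawn_graph : {set {set 'I_29}} := [set:: map drawn_edge edges].

Lemma edge_image_drawn (f : 'I_29 -> nat) j :
  edge_image f (drawn_edge (ed j)) = cp (fun v => f (inord v)) j.
Proof.
rewrite /edge_image /cp /img (map_comp f inord).
apply/(perm_sortP leq_total leq_trans anti_leq); apply: perm_map.
have inordI : {in ed j &, injective (inord : nat -> 'I_29)}.
  by move=> v w /ed_lt lt_v /ed_lt lt_w /(congr1 val); rewrite /= !inordK.
apply: uniq_perm; rewrite ?enum_uniq ?map_inj_in_uniq ?ed_uniq // => i.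
rewrite mem_enum inE; apply/idP/mapP => [ij|[v vj ->]].
  by exists (i : nat); rewrite ?inord_val.
by rewrite inordK ?(ed_lt vj).
Qed.

Lemma mem_drawn j : j < 20 -> drawn_edge (ed j) \in drawn_graph.
Proof. by move=> lt_j; rewrite inE map_f // mem_nth. Qed.

Lemma drawnP e : e \in drawn_graph -> exists2 j, j < 20 & e = drawn_edge (ed j).
Proof.
rewrite inE => /mapP[s sE ->]; exists (index s edges); first by rewrite -index_mem in sE.
by rewrite /ed nth_index.
Qed.

Lemma has_copyP L : has_copy drawn_graph L <-> exists g, copy g L.
Proof.
split=> [[f [fI fL]]|[g [gI gL]]].
  exists (fun v => f (inord v)); split=> [v w lt_v lt_w /fI/(congr1 val)|j lt_j].
    by rewrite /= !inordK.
  by rewrite -edge_image_drawn; apply: fL; exact: mem_drawn.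
exists (fun i : 'I_29 => g i).
split=> [i k /(gI _ _ (ltn_ord i) (ltn_ord k))/val_inj//|e].
case/drawnP=> j lt_j ->; rewrite edge_image_drawn.
by rewrite (@eq_cp _ g) ?gL // => v lt_v; rewrite inordK.
Qed.

Lemma drawn_uniform : uniform 5 drawn_graph.
Proof.
move=> e /drawnP[j lt_j ->]; rewrite cardE.
have /andP[_ /eqP sz] := ed_sorted lt_j.
have := congr1 size (edge_image_drawn (fun i : 'I_29 => i : nat) j).
by rewrite !size_sort !size_map => ->.
Qed.

(** Excludes a degenerate witness: with no edges, both players own a copy from the start and neither
    can win. *)
Lemma drawn_neq0 : drawn_graph != set0.
Proof. by apply/set0Pn; exists (drawn_edge (ed 0)); exact: mem_drawn. Qed.

Lemma fresh_edge (h : seq (seq nat)) : exists y, edgeK 5 y && (y \notin h).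
Proof.
have [N H] := bound h; exists (cp (addn N) 0); apply/andP; split.
  by apply: cp_edge => // v w _ _ /addnI.
have N0 : N \in cp (addn N) 0 by apply/cpP; exists 0; rewrite ?addn0.
by apply/negP => /H/(_ N0); rewrite ltnn.
Qed.

Lemma mkseqS (p : nat -> seq nat) n : mkseq p n.+1 = rcons (mkseq p n) (p n).
Proof. by rewrite /mkseq -addn1 iotaD map_cat cats1. Qed.

Lemma mem_mkseq (p : nat -> seq nat) n x :
  reflect (exists2 i, i < n & x = p i) (x \in mkseq p n).
Proof.
apply: (iffP mapP) => -[i]; rewrite ?mem_iota => lt_i ->; exists i => //.
by rewrite mem_iota.
Qed.

Lemma mem_claimed b (p : nat -> seq nat) n x :
  reflect (exists2 i, i < n & odd i = b /\ x = p i) (x \in claimed b (mkseq p n)).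
Proof.
rewrite /claimed size_mkseq; apply: (iffP mapP) => -[i].
  rewrite mem_filter mem_iota => /andP[/eqP bi /= lt_i] ->; exists i => //.
  by rewrite nth_mkseq.
move=> lt_i [bi ->]; exists i; last by rewrite nth_mkseq.
by rewrite mem_filter mem_iota bi eqxx.
Qed.

Lemma claimedS b (p : nat -> seq nat) n :
  claimed b (mkseq p n.+1) =
    if odd n == b then rcons (claimed b (mkseq p n)) (p n)
    else claimed b (mkseq p n).
Proof.
rewrite {1}/claimed size_mkseq -addn1 iotaD filter_cat map_cat /= add0n.
rewrite (_ : map _ (filter _ (iota 0 n)) = claimed b (mkseq p n)); last first.
  rewrite /claimed size_mkseq; apply/eq_in_map => i.
  rewrite mem_filter mem_iota => /andP[_ /= lt_i].
  by rewrite !nth_mkseq ?addn1 // ltnS ltnW.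
by case: ifP => _ /=; rewrite ?cats0 // cats1 nth_mkseq ?addn1.
Qed.

Lemma legalS (p : nat -> seq nat) n :
  legal 5 (mkseq p n.+1) =
    [&& legal 5 (mkseq p n), edgeK 5 (p n) & p n \notin mkseq p n].
Proof.
rewrite mkseqS /legal all_rcons rcons_uniq.
by case: (edgeK _ _); case: (all _ _); case: (_ \notin _); case: (uniq _).
Qed.

Lemma legal_le (p : nat -> seq nat) m n : m <= n ->
  legal 5 (mkseq p n) -> legal 5 (mkseq p m).
Proof.
elim: n => [|n IHn]; first by rewrite leqn0 => /eqP->.
rewrite leq_eqVlt => /predU1P[->//|lt_m]; rewrite legalS => /and3P[Ln _ _].
exact: IHn.
Qed.

Lemma has_copy_sub (V : finType) (G : {set {set V}}) L M :
  {subset L <= M} -> has_copy G L -> has_copy G M.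
Proof. by move=> LM [f [fI fL]]; exists f; split=> // e /fL/LM. Qed.

(** * The first player has no winning strategy *)

Section SecondPlayerDraws.

Let FPs h := rev (claimed false h).
Let SPs h := rev (claimed true h).

(** The move is legal on every history, even where no safe reply exists, so a total strategy can be
    extracted by choice. *)
Lemma safe_move (h : seq (seq nat)) : exists y,
  [/\ edgeK 5 y, y \notin h & reply (FPs h) (SPs h) ->
      {subset h <= FPs h ++ SPs h} -> safe (FPs h) (y :: SPs h)].
Proof.
case: (classic (reply (FPs h) (SPs h) /\ {subset h <= FPs h ++ SPs h})).
  case=> [[y [ey yF yS s]] sub]; exists y; split=> //.
  by apply/negP => /sub; rewrite mem_cat (negbTE yF) (negbTE yS).
move=> N; have [y /andP[ey yh]] := fresh_edge h; exists y; split=> // r sub.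
by case: N.
Qed.

Definition safe_strategy (h : seq (seq nat)) : seq nat :=
  proj1_sig (constructive_indefinite_description _ (safe_move h)).

Lemma safe_strategyP h :
  [/\ edgeK 5 (safe_strategy h), safe_strategy h \notin h
    & reply (FPs h) (SPs h) -> {subset h <= FPs h ++ SPs h} ->
      safe (FPs h) (safe_strategy h :: SPs h)].
Proof. exact: (proj2_sig (constructive_indefinite_description _ (safe_move h))). Qed.

Variable sigma : strategy.

Fixpoint history n : seq (seq nat) :=
  if n is m.+1 then
    rcons (history m) (if odd m then safe_strategy (history m) else sigma (history m))
  else [::].

Let play n := if odd n then safe_strategy (history n) else sigma (history n).

Lemma mkseq_play n : mkseq play n = history n.
Proof. by elim: n => // n IHn; rewrite mkseqS IHn. Qed.

Lemma play_follows : follows false sigma play.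
Proof. by move=> n n_even; rewrite mkseq_play /play n_even. Qed.

Lemma play_safe_strategy n : odd n -> play n = safe_strategy (mkseq play n).
Proof. by move=> n_odd; rewrite mkseq_play /play n_odd. Qed.

Lemma play_opp_legal : opp_legal 5 false play.
Proof.
move=> n /= n_odd; rewrite play_safe_strategy //.
by have [] := safe_strategyP (mkseq play n).
Qed.

Lemma mem_history n : mkseq play n =i FPs (mkseq play n) ++ SPs (mkseq play n).
Proof.
move=> x; rewrite mem_cat !mem_rev; apply/mem_mkseq/orP.
  case=> i lt_i ->; case: (boolP (odd i)) => oi; [right|left];
    by apply/mem_claimed; exists i; rewrite ?oi ?(negbTE oi).
by case=> /mem_claimed[i lt_i [_ ->]]; exists i.
Qed.

Let ok n := (forall g, ~ copy g (FPs (mkseq play n))) \/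
            exists g, copy g (SPs (mkseq play n)).

(** Legality is assumed because [sigma] may propose illegal moves; a winning position has to be
    legal anyway. *)
Lemma play_safe n : legal 5 (mkseq play n) ->
  ok n /\ if odd n then reply (FPs (mkseq play n)) (SPs (mkseq play n))
          else safe (FPs (mkseq play n)) (SPs (mkseq play n)).
Proof.
elim: n => [_|n IHn].
  by split; [left=> g /copy_size|exact: safe_nil].
rewrite legalS => /and3P[Ln en nn]; have [okn In] := IHn Ln.
rewrite /ok /FPs /SPs !claimedS /=.
case: (boolP (odd n)) In => /= on In; last first.
  rewrite rev_rcons; apply: safe_step => //;
    by apply: contra nn => xn; rewrite mem_history mem_cat xn ?orbT.
rewrite rev_rcons; split.
  case: okn => [nF|[g gS]]; [by left|right; exists g].
  by apply: copy_sub gS => y yS; rewrite in_cons yS orbT.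
rewrite play_safe_strategy //.
have [_ _] := safe_strategyP (mkseq play n); apply=> // x.
by rewrite mem_history.
Qed.

Lemma not_winning_first : ~ winning 5 drawn_graph false sigma.
Proof.
move=> /(_ play play_follows play_opp_legal) [n [Ln [cF cS]]].
have [[nF|[g gS]] _] := play_safe Ln.
  case/has_copyP: cF => g gF; case: (nF g); apply: copy_sub gF => x.
  by rewrite mem_rev.
apply: cS; apply/has_copyP; exists g; apply: copy_sub gS => x.
by rewrite mem_rev.
Qed.

End SecondPlayerDraws.

(** * The second player has no winning strategy *)

(* The first player answers in the game [p] by copying the replies of [sigma]
   in an imaginary game [q], in which the roles are exchanged and his very
   first edge is ignored. *)
Section StrategyStealing.
Variables (V : finType) (G : {set {set V}}) (sigma : strategy).
Hypothesis win : winning 5 G true sigma.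

Let fresh h := xchoose (fresh_edge h).

(** Replaces a proposal that is not a legal move by an arbitrary legal one, so that the copying
    player always moves legally. *)
Let fix_move h x := if edgeK 5 x && (x \notin h) then x else fresh h.

Let fix_moveP h x : edgeK 5 (fix_move h x) /\ fix_move h x \notin h.
Proof.
rewrite /fix_move; case: ifP => [/andP[]//|_].
by have /andP[] := xchooseP (fresh_edge h).
Qed.

(** Each round adds one move of either player to both games; the first component, the position in
    [p], is longer by the extra first edge. *)
Fixpoint games n : seq (seq nat) * seq (seq nat) :=
  if n is m.+1 then
    let: (P, Q) := games m in
    let P' := rcons P (sigma P) in
    let Q' := rcons Q (fix_move Q (sigma P)) in
    (rcons P' (fix_move P' (sigma Q')), rcons Q' (sigma Q'))
  else ([:: fresh [::]], [::]).

Let p n := if odd n then sigma (games n./2).1 else last [::] (games n./2).1.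

Let q n := if odd n then last [::] (games n./2.+1).2
  else fix_move (games n./2).2 (sigma (games n./2).1).

Lemma games_p n : (games n).1 = mkseq p n.*2.+1.
Proof.
elim: n => [|n IHn]; first by [].
rewrite doubleS !mkseqS -mkseqS -IHn /p /= odd_double uphalf_double /=.
by rewrite doubleK /=; case: (games n) => P Q /=; rewrite last_rcons.
Qed.

Lemma games_q n : (games n).2 = mkseq q n.*2.
Proof.
elim: n => [|n IHn]; first by [].
rewrite doubleS !mkseqS -IHn /q /= odd_double uphalf_double doubleK /=.
by case: (games n) => P Q /=; rewrite last_rcons.
Qed.

Lemma p_odd i : p i.*2.+1 = sigma (mkseq p i.*2.+1).
Proof. by rewrite -games_p {1}/p /= odd_double uphalf_double. Qed.

Lemma p_even i : p i.*2.+2 = fix_move (mkseq p i.*2.+2) (q i.*2.+1).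
Proof.
rewrite mkseqS p_odd -games_p {1}/p /q /= odd_double /= doubleK uphalf_double.
by case: (games i) => P Q /=; rewrite !last_rcons.
Qed.

Lemma q_even i : q i.*2 = fix_move (mkseq q i.*2) (p i.*2.+1).
Proof. by rewrite p_odd -games_p -games_q {1}/q odd_double doubleK. Qed.

Lemma q_odd i : q i.*2.+1 = sigma (mkseq q i.*2.+1).
Proof.
rewrite mkseqS q_even -games_q p_odd -games_p {1}/q /= odd_double /= uphalf_double.
by case: (games i) => P Q /=; rewrite last_rcons.
Qed.

Lemma odd_form i : odd i -> i = i./2.*2.+1.
Proof. by move=> oi; rewrite -{1}(odd_double_half i) oi. Qed.

Lemma even_form i : odd i = false -> i = i./2.*2.
Proof. by move=> oi; rewrite -{1}(odd_double_half i) oi. Qed.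

Lemma p_follows : follows true sigma p.
Proof. by move=> i /odd_form->; exact: p_odd. Qed.

Lemma q_follows : follows true sigma q.
Proof. by move=> i /odd_form->; exact: q_odd. Qed.

Lemma p_opp_legal : opp_legal 5 true p.
Proof.
move=> i /even_form->; case: (i./2) => [|j]; last by rewrite doubleS p_even.
by have /andP[] := xchooseP (fresh_edge [::]).
Qed.

Lemma q_opp_legal : opp_legal 5 true q.
Proof. by move=> i /even_form->; rewrite q_even. Qed.

Lemma q_even_copy i : legal 5 (mkseq p i.*2.+2) ->
  {subset mkseq q i.*2 <= mkseq p i.*2.+1} -> q i.*2 = p i.*2.+1.
Proof.
rewrite legalS => /and3P[_ e n] sub; rewrite q_even /fix_move e.
by rewrite (contra (sub _) n).
Qed.

Lemma games_sub i :
  (forall j, j < i -> q j.*2 = p j.*2.+1) ->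
  (forall j, j < i -> exists2 l, l <= i & p l.*2 = q j.*2.+1) ->
  {subset mkseq q i.*2 <= mkseq p i.*2.+1}.
Proof.
move=> IH1 IH2 x /mem_mkseq[k lt_k ->]; apply/mem_mkseq.
have lt_k2 : k./2 < i by lia.
case: (boolP (odd k)) => [/odd_form|/negbTE/even_form] Ek; rewrite Ek.
  have [l le_l <-] := IH2 _ lt_k2; exists l.*2 => //.
  by rewrite ltnS leq_double.
by rewrite IH1 //; exists k./2.*2.+1; rewrite // ltnS ltn_double.
Qed.

(** As long as both games are legal, the edges of the second player in [p] are those of the first
    player in [q], and the edges of the second player in [q] are owned by the first player in [p],
    though perhaps from an earlier move. *)
Lemma games_agree i :
  legal 5 (mkseq p i.*2.+1) -> legal 5 (mkseq q i.*2) ->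
  (forall j, j < i -> q j.*2 = p j.*2.+1) /\
  (forall j, j < i -> exists2 l, l <= i & p l.*2 = q j.*2.+1).
Proof.
elim: i => [//|i IHi]; rewrite doubleS => Lp Lq.
have Lp' : legal 5 (mkseq p i.*2.+2) by exact: legal_le Lp.
have Lq' : legal 5 (mkseq q i.*2.+1) by exact: legal_le Lq.
have [||IH1 IH2] := IHi; [exact: legal_le Lp'|exact: legal_le Lq'|].
have qi := q_even_copy Lp' (games_sub IH1 IH2).
have IH1' j : j <= i -> q j.*2 = p j.*2.+1.
  by rewrite leq_eqVlt => /predU1P[->//|]; exact: IH1.
split=> j; rewrite ltnS; first exact: IH1'.
rewrite leq_eqVlt => /predU1P[->|lt_j]; last first.
  by have [l le_l El] := IH2 j lt_j; exists l => //; exact: leqW.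
move: Lq; rewrite legalS => /and3P[_ e n].
(* If the edge to be copied is already taken in [p], the second player cannot own it, as the same
   edge would have been played before in [q]; so the first player has it already. *)
case: (boolP (q i.*2.+1 \in mkseq p i.*2.+2)) => [|np]; last first.
  by exists i.+1; rewrite // doubleS p_even /fix_move e np.
case/mem_mkseq=> k lt_k Ek.
have le_k2 : k./2 <= i by lia.
case: (boolP (odd k)) => [/odd_form|/negbTE/even_form] E; last first.
  by exists k./2; [exact: leqW|rewrite -E].
case/negP: n; rewrite Ek E -IH1' //; apply/mem_mkseq; exists k./2.*2 => //.
by rewrite ltnS leq_double.
Qed.

(** Since [sigma] wins both games, compare the winning times: the copy that wins the game decided in
    the earlier round is also owned by the first player of the other game at its winning
    position. *)
Lemma stolen_strategy_contra : False.
Proof.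
have [m [Lm [pSP pFP]]] := win p_follows p_opp_legal.
have [n [Ln [qSP qFP]]] := win q_follows q_opp_legal.
case: (leqP m./2 n./2) => [le_mn|lt_nm].
  apply: qFP; apply: has_copy_sub pSP => x /mem_claimed[k lt_k [/odd_form Ek ->]].
  have Lp : legal 5 (mkseq p k./2.*2.+2).
    by apply: legal_le Lm; rewrite -Ek.
  have lt_n : k./2.*2 < n by lia.
  have [||IH1 IH2] := @games_agree k./2; first exact: legal_le Lp.
    by apply: legal_le Ln; exact: ltnW.
  apply/mem_claimed; exists k./2.*2 => //.
  by rewrite odd_double (q_even_copy Lp (games_sub IH1 IH2)) -Ek.
apply: pFP; apply: has_copy_sub qSP => x /mem_claimed[k lt_k [/odd_form Ek ->]].
have lt_j : k./2 < n./2 by lia.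
have [||_ /(_ _ lt_j)[l le_l El]] := @games_agree n./2.
- by apply: legal_le Lm; lia.
- by apply: legal_le Ln; lia.
apply/mem_claimed; exists l.*2; first by lia.
by rewrite odd_double Ek El.
Qed.

End StrategyStealing.

Theorem theorem1p1 :
  exists (V : finType) (E : {set {set V}}),
    E != set0 /\ uniform 5 E /\ strong_game_draw 5 E.
Proof.
exists 'I_29, drawn_graph; split; first exact: drawn_neq0.
split; first exact: drawn_uniform.
by split=> -[sigma win];
  [exact: not_winning_first win | exact: stolen_strategy_contra win].
Qed.
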